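(* Let $(M,\pi_0,\mathcal{N})$ be an orientable Poisson-Nijenhuis manifold, $\pi_1=\mathcal{N}\pi_0$, and let $X_{\mathcal{N}}$ be its modular vector field. Then the Poisson cohomology class $[X_{\mathcal{N}}]\in H^1_{\pi_1}(M)$ equals half the relative modular class of the Lie algebroid morphism $$\mathcal{N}^*:(T^*M,[\cdot,\cdot]_{\pi_1},\pi_1^\sharp)\to(T^*M,[\cdot,\cdot]_{\pi_0},\pi_0^\sharp).$$
   Context: Everything is smooth. For a Poisson manifold $(M,\pi)$: $\{f,g\}=\pi(\mathrm{d}f,\mathrm{d}g)$, $\pi^\sharp:T^*M\to TM$ is defined by $\langle\beta,\pi^\sharp\alpha\rangle=\pi(\alpha,\beta)$, and $X_h=\pi^\sharp\mathrm{d}h=\{h,\cdot\}$. For a volume form $\mu$, $\mathcal{L}_X\mu=\operatorname{div}_\mu(X)\mu$, and the modular vector field of $\pi$ relative to $\mu$ is the vector field $X_\mu$ with $X_\mu(f)=\operatorname{div}_\mu(X_f)$ for all $f$. $H^1_\pi(M)$ is the space of Poisson vector fields (those with $\mathcal{L}_X\pi=0$) modulo hamiltonian vector fields. The cotangent bundle $T^*M$ is a Lie algebroid with anchor $\pi^\sharp$ and bracket $[\alpha,\beta]_\pi=\mathcal{L}_{\pi^\sharp\alpha}\beta-\mathcal{L}_{\pi^\sharp\beta}\alpha-\mathrm{d}(\pi(\alpha,\beta))$; its first Lie algebroid cohomology, computed from 1-cochains in $\Gamma((T^*M)^* )=\mathfrak{X}(M)$, is $H^1_\pi(M)$. A Poisson-Nijenhuis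 manifold $(M,\pi_0,\mathcal{N})$ is a manifold $M$ with a Poisson structure $\pi_0$ and a $(1,1)$-tensor $\mathcal{N}:TM\to TM$ such that: (i) $\mathcal{N}[\mathcal{N}X,Y]+\mathcal{N}[X,\mathcal{N}Y]-\mathcal{N}^2[X,Y]-[\mathcal{N}X,\mathcal{N}Y]=0$ for all vector fields $X,Y$; (ii) $\mathcal{N}\pi_0^\sharp=\pi_0^\sharp\mathcal{N}^*$ ($\mathcal{N}^*$ is the transpose), so that $\pi_1=\mathcal{N}\pi_0$, defined by $\pi_1^\sharp=\mathcal{N}\pi_0^\sharp$, is a bivector field; (iii) $[\alpha,\beta]_{\pi_1}=[\mathcal{N}^*\alpha,\beta]_{\pi_0}+[\alpha,\mathcal{N}^*\beta]_{\pi_0}-\mathcal{N}^*[\alpha,\beta]_{\pi_0}$ for all 1-forms $\alpha,\beta$. Then $\pi_1$ is a Poisson tensor and $\mathcal{N}^*$ is a Lie algebroid morphism as displayed in the claim. The modular vector field of $(M,\pi_0,\mathcal{N})$ is $X_{\mathcal{N}}:=X^1_\mu-\mathcal{N}X^0_\mu$, where $X^0_\mu,X^1_\mu$ are the modular vector fields of $\pi_0,\pi_1$ relative to a volume form $\mu$; it does not depend on $\mu$ and is a Poisson vector field of $\pi_1$. Relative modular class: for a morphism $\phi:A\to B$ of Lie algebroids over the identity of $M$ with $\wedge^{\mathrm{top}}A$, $\wedge^{\mathrm{top}}B$ trivial, choose nowhere vanishing $\eta\in\Gamma(\wedge^{\mathrm{top}}A)$ and $\nu\in\Gamma(\wedge^{\mathrm{top}}B^*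 )$; $\xi^\phi_{A,B}\in\Gamma(A^* )$ is defined by $$(\mathcal{L}^A_\alpha\eta)\otimes\nu+\eta\otimes(\mathcal{L}^B_{\phi(\alpha)}\nu)=\xi^\phi_{A,B}(\alpha)\,\eta\otimes\nu\qquad\text{for all }\alpha\in\Gamma(A),$$ where $\mathcal{L}^A,\mathcal{L}^B$ are the Lie algebroid Lie derivatives. It is a cocycle, and its class $\operatorname{mod}(A,B,\phi)=[\xi^\phi_{A,B}]\in H^1(A)$ (the relative modular class) does not depend on $\eta,\nu$. *)

(* Defs.v *)
From HB Require Import structures.
From mathcomp Require Import all_boot all_order all_algebra.
From mathcomp Require Import boolp classical_sets functions reals.
From mathcomp Require Import topology normedtype derive.
From mathcomp Require Import ring.

Set Implicit Arguments.
Unset Strict Implicit.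
Unset Printing Implicit Defensive.
Import Order.TTheory GRing.Theory Num.Theory.
Import numFieldNormedType.Exports.

Local Open Scope classical_set_scope.
Local Open Scope ring_scope.

Section SmoothEuclidean.
Context {R : realType} {n : nat}.
Implicit Types (O : set 'rV[R]_n) (g h : 'rV[R]_n -> R) (k : nat).

(* [O] is meant to be open: all partial derivatives of order at most [k] exist
   and are continuous at every point of [O]. *)
Fixpoint Ck k O g : Prop :=
  (forall x, O x -> {for x, continuous g}) /\
  if k is k'.+1 then
    forall i : 'I_n, (forall x, O x -> derivable g x (delta_mx 0 i)) /\
                     Ck k' O ('D_(delta_mx 0 i) g)
  else True.

Definition smooth_on O g := forall k, Ck k O g.

Lemma near_open O g h x : open O -> (forall y, O y -> g y = h y) -> O x ->
  \near x, g x = h x.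
Proof. by move=> oO gh Ox; apply: (filterS gh); exact: open_nbhs_nbhs. Qed.

Lemma Ck_ext k O g h : open O -> (forall x, O x -> g x = h x) ->
  Ck k O g -> Ck k O h.
Proof.
move=> oO; elim: k g h => [|k IH] g h gh /= [cg Hg]; split => //.
- move=> x Ox; rewrite /prop_for /continuous_at -gh //.
  exact: (cvg_trans (near_eq_cvg (near_open oO gh Ox)) (cg x Ox)).
- move=> x Ox; rewrite /prop_for /continuous_at -gh //.
  exact: (cvg_trans (near_eq_cvg (near_open oO gh Ox)) (cg x Ox)).
move=> i; have [dg Dg] := Hg i; split=> [x Ox|].
  by apply: near_eq_derivable (dg x Ox); exact: (near_open oO gh Ox).
by apply: IH Dg => x Ox; apply: near_eq_derive; exact: (near_open oO gh Ox).
Qed.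

Lemma CkS k O g : Ck k.+1 O g -> Ck k O g.
Proof.
elim: k g => [|k IH] g; first by case.
by case=> cg Hg; split=> // i; have [dg /IH Dg] := Hg i.
Qed.

Lemma Ck_cst k O (a : R) : Ck k O (cst a).
Proof.
elim: k a => [|k IH] a; split=> //; try by move=> x _; exact: (@cvg_cst _ a _ _ (nbhs_filter x)).
move=> i; split=> [x _|]; first exact: derivable_cst.
suff -> : 'D_(delta_mx 0 i) (cst a : 'rV[R]_n -> R) = cst 0 by exact: IH.
by apply/funext => x; exact: derive_cst.
Qed.

Lemma CkD k O g h : open O -> Ck k O g -> Ck k O h -> Ck k O (g \+ h).
Proof.
move=> oO; elim: k g h => [|k IH] g h [cg Hg] [ch Hh]; split=> //;
  try by move=> x Ox; apply: continuousD; [exact: cg|exact: ch].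
move=> i; have [dg Dg] := Hg i; have [dh Dh] := Hh i; split=> [x Ox|].
  by apply: derivableD; [exact: dg|exact: dh].
apply: Ck_ext (IH _ _ Dg Dh) => // x Ox.
by rewrite deriveD //; [exact: dg|exact: dh].
Qed.

Lemma CkM k O g h : open O -> Ck k O g -> Ck k O h -> Ck k O (g \* h).
Proof.
move=> oO; elim: k g h => [|k IH] g h Cg Ch;
  have [cg Hg] := Cg; have [ch Hh] := Ch; split=> //;
  try by move=> x Ox; apply: continuousM; [exact: cg|exact: ch].
move=> i; have [dg Dg] := Hg i; have [dh Dh] := Hh i; split=> [x Ox|].
  by apply: derivableM; [exact: dg|exact: dh].
apply: Ck_ext (CkD oO (IH _ _ (CkS Cg) Dh) (IH _ _ (CkS Ch) Dg)) => // x Ox.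
by rewrite deriveM //; [exact: dg|exact: dh].
Qed.

End SmoothEuclidean.

(* [loc] and [par] are the chart and its inverse; only their restrictions to
   [dom] and [loc @` dom] matter. *)
Record chart (R : realType) (n : nat) (M : Type) := Chart {
  dom : set M;
  loc : M -> 'rV[R]_n;
  par : 'rV[R]_n -> M }.

Definition cod R n M (c : chart R n M) : set 'rV[R]_n := loc c @` dom c.

Record manifold (R : realType) (n : nat) := Manifold {
  points :> topologicalType;
  hausdorffM : hausdorff_space points;
  second_countableM : @second_countable points;
  atlas : set (chart R n points);
  atlas_cover : forall p, exists2 c, atlas c & dom c p;
  open_dom : forall c, atlas c -> open (dom c);
  open_cod : forall c, atlas c -> open (cod c);
  locK : forall c, atlas c -> forall p, dom c p -> par c (loc c p) = p;
  loc_continuous : forall c, atlas c ->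
    forall p, dom c p -> {for p, continuous (loc c)};
  par_continuous : forall c, atlas c ->
    forall x, cod c x -> {for x, continuous (par c)};
  atlas_smooth : forall c e, atlas c -> atlas e -> forall i,
    smooth_on (loc c @` (dom c `&` dom e)) (fun x => loc e (par c x) 0 i) }.

Section SmoothFunctions.
Context {R : realType} {n : nat} (M : manifold R n).

Definition smooth (f : M -> R) :=
  forall c, @atlas R n M c -> smooth_on (cod c) (f \o par c).

Definition smooth_pred : {pred M -> R} := fun f => `[< smooth f >].

Lemma smooth_cst (a : R) : cst a \in smooth_pred.
Proof. by apply/asboolP => c _ k; exact: Ck_cst. Qed.

Lemma smooth_subring : subring_closed smooth_pred.
Proof.
have sM f g : f \in smooth_pred -> g \in smooth_pred -> f * g \in smooth_pred.
  move=> /asboolP sf /asboolP sg; apply/asboolP => c Mc k.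
  by apply: CkM; [exact: open_cod|exact: sf|exact: sg].
split=> [|f g sf sg|//]; first exact: smooth_cst.
have /asboolP sNg : - g \in smooth_pred.
  by rewrite -mulN1r; apply: sM => //; exact: (smooth_cst (-1)).
move/asboolP: sf => sf; apply/asboolP => c Mc k.
by apply: CkD; [exact: open_cod|exact: sf|exact: sNg].
Qed.

HB.instance Definition _ :=
  GRing.isSubringClosed.Build (M -> R) smooth_pred smooth_subring.

Record Coo := SmoothFun { fun_of_Coo :> M -> R; _ : fun_of_Coo \in smooth_pred }.

HB.instance Definition _ := [isSub for fun_of_Coo].
HB.instance Definition _ := [Choice of Coo by <:].
HB.instance Definition _ := 
  GRing.SubChoice_isSubComPzRing.Build (M -> R) smooth_pred Coo (subringClosedP _).

Definition constC (a : R) : Coo := SmoothFun (smooth_cst a).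

End SmoothFunctions.

Section Modules.
Context {K : comPzRingType} (L : lmodType K).

Definition linear_pred : {pred L -> K^o} := fun xi =>
  `[< forall a x y, xi (a *: x + y) = a * xi x + xi y >].

Lemma linear_pred_submod : submod_closed linear_pred.
Proof.
split=> [|a xi zeta /asboolP xiP /asboolP zetaP].
  by apply/asboolP => a x y; rewrite mulr0 addr0.
apply/asboolP => b x y; rewrite !fctE xiP zetaP /GRing.scale /=.
by rewrite !mulrDr mulrCA addrACA.
Qed.

HB.instance Definition _ :=
  GRing.isSubmodClosed.Build K (L -> K^o) linear_pred linear_pred_submod.

Record dual := Dual { dual_val : L -> K^o; _ : dual_val \in linear_pred }.

HB.instance Definition _ := [isSub for dual_val].
HB.instance Definition _ := [Choice of dual by <:].
HB.instance Definition _ := [SubChoice_isSubLmodule of dual by <:].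

Definition dual_fun (xi : dual) : L -> K := dual_val xi.
Coercion dual_fun : dual >-> Funclass.

Lemma dual_is_linear (xi : dual) a x y : xi (a *: x + y) = a * xi x + xi y.
Proof. by case: xi => f /asboolP/= ->. Qed.

Lemma dualDr (xi : dual) x y : xi (x + y) = xi x + xi y.
Proof. by rewrite -[x]scale1r dual_is_linear mul1r scale1r. Qed.

Lemma dualZr (xi : dual) a x : xi (a *: x) = a * xi x.
Proof.
have xi0 : xi 0 = 0 by apply: (addrI (xi 0)); rewrite -dualDr !addr0.
by rewrite -[X in xi X]addr0 dual_is_linear xi0 addr0.
Qed.

Lemma dualNr (xi : dual) x : xi (- x) = - xi x.
Proof. by rewrite -scaleN1r dualZr mulN1r. Qed.

Lemma dualDl (xi zeta : dual) x : (xi + zeta) x = xi x + zeta x.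
Proof. by []. Qed.

Lemma dualZl a (xi : dual) x : (a *: xi) x = a * xi x.
Proof. by []. Qed.

Definition update r (v : 'I_r -> L) (i : 'I_r) (x : L) : 'I_r -> L :=
  fun j => if j == i then x else v j.

(* The sections of the [r]-th exterior power of the dual of the bundle whose
   module of sections is [L]. *)
Definition alternating_form r (w : ('I_r -> L) -> K) :=
  (forall v i a x y,
     w (update v i (a *: x + y)) = a * w (update v i x) + w (update v i y)) /\
  (forall v i j, i != j -> v i = v j -> w v = 0).

(* The action on forms of a derivation [T] of [L] covering the derivation [D]
   of [K]. *)
Definition form_derivation r (D : K -> K) (T : L -> L) (w : ('I_r -> L) -> K)
    (v : 'I_r -> L) : K :=
  D (w v) - \sum_(i < r) w (update v i (T (v i))).

End Modules.

Section Fields.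
Context {R : realType} {n : nat} (M : manifold R n).
Local Notation C := (Coo M).
Implicit Types (f g h : C).

(* Vector fields are the R-linear derivations of the algebra of smooth
   functions, and one-forms the linear forms on vector fields over that
   algebra. *)
Definition derivation_pred : {pred C -> C^o} := fun D =>
  `[< [/\ forall f g, D (f + g) = D f + D g,
          forall a f, D (constC M a * f) = constC M a * D f &
          forall f g, D (f * g) = f * D g + g * D f] >].

Lemma derivation_pred_submod : submod_closed derivation_pred.
Proof.
split=> [|a D E /asboolP[DD Dc DM] /asboolP[ED Ec EM]]; apply/asboolP; split.
- by move=> f g; rewrite addr0.
- by move=> c f; rewrite mulr0.
- by move=> f g; rewrite !mulr0 addr0.
- by move=> f g; rewrite !fctE DD ED /GRing.scale/= mulrDr addrACA.
- by move=> c f; rewrite !fctE Dc Ec /GRing.scale/= mulrCA mulrDr.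
- move=> f g; rewrite !fctE DM EM /GRing.scale/= !mulrDr addrACA.
  by rewrite !(mulrCA a).
Qed.

HB.instance Definition _ := GRing.isSubmodClosed.Build C (C -> C^o)
  derivation_pred derivation_pred_submod.

Record vfield :=
  VField { vfield_val : C -> C^o; _ : vfield_val \in derivation_pred }.

HB.instance Definition _ := [isSub for vfield_val].
HB.instance Definition _ := [Choice of vfield by <:].
HB.instance Definition _ := [SubChoice_isSubLmodule of vfield by <:].

Definition vfield_fun (X : vfield) : C -> C := vfield_val X.
Coercion vfield_fun : vfield >-> Funclass.

Lemma vfieldP (X : vfield) :
  [/\ forall f g, X (f + g) = X f + X g,
      forall a f, X (constC M a * f) = constC M a * X f &
      forall f g, X (f * g) = f * X g + g * X f].
Proof. by case: X => D DP; move/asboolP: (DP). Qed.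

Lemma vfield0 (X : vfield) : X 0 = 0.
Proof. by have [XD _ _] := vfieldP X; apply: (addrI (X 0)); rewrite -XD !addr0. Qed.

Lemma lie_vf_subproof (X Y : vfield) :
  (fun f => X (Y f) - Y (X f)) \in derivation_pred.
Proof.
have [XD Xc XM] := vfieldP X; have [YD Yc YM] := vfieldP Y.
apply/asboolP; split=> [f g|a f|f g].
- by rewrite YD XD XD YD opprD addrACA.
- by rewrite Yc Xc Xc Yc mulrBr.
by rewrite YM XM XD YD !XM !YM; ring.
Qed.

Definition lie_vf (X Y : vfield) : vfield := VField (lie_vf_subproof X Y).

End Fields.

Notation oneform M := (dual (vfield M)).

Section Differential.
Context {R : realType} {n : nat} {M : manifold R n}.

Lemma ext_diff_subproof (f : Coo M) :
  (fun X : vfield M => X f) \in @linear_pred _ (vfield M).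
Proof. by apply/asboolP. Qed.

Definition ext_diff (f : Coo M) : oneform M := Dual (ext_diff_subproof f).

End Differential.

(* Vector bundles are represented by their modules of sections. The Jacobi
   identity and the compatibility of morphisms with brackets play no role in
   the definition of Lie derivatives and of the relative modular cocycle, hence
   they are not part of this structure; what is left is the Leibniz rule, which
   makes the Lie derivative of a section of the dual bundle a section again. *)
Record skew_algebroid (R : realType) (n : nat) (M : manifold R n) :=
  SkewAlgebroid {
    sections :> lmodType (Coo M);
    rank : nat;
    anchor : {linear sections -> vfield M};
    bracket : sections -> sections -> sections;
    bracketxx : forall a, bracket a a = 0;
    bracketDr : forall a b c, bracket a (b + c) = bracket a b + bracket a c;
    bracketZr : forall a f b,
      bracket a (f *: b) = f *: bracket a b + anchor a f *: b }.

Arguments anchor {R n M s}.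

Section SkewAlgebroid.
Context {R : realType} {n : nat} {M : manifold R n} (A : skew_algebroid M).
Local Notation C := (Coo M).

Lemma lie_dual_subproof (a : A) (xi : dual A) :
  (fun b => anchor a (xi b) - xi (bracket a b)) \in @linear_pred _ A.
Proof.
have [XD _ XM] := vfieldP (anchor a).
apply/asboolP => f x y; rewrite bracketDr bracketZr -addrA.
by rewrite !dual_is_linear XD XM; ring.
Qed.

Definition lie_dual (a : A) (xi : dual A) : dual A :=
  Dual (lie_dual_subproof a xi).

Definition lie_form r (a : A) (w : ('I_r -> A) -> C) :=
  form_derivation (anchor a) (bracket a) w.

(* Acts on sections of the exterior powers of the bundle itself, which are forms
   on the dual bundle. *)
Definition lie_multivector r (a : A) (w : ('I_r -> dual A) -> C) :=
  form_derivation (anchor a) (lie_dual a) w.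

Lemma coboundary_subproof (f : C) :
  (fun a => anchor a f) \in @linear_pred _ A.
Proof. by apply/asboolP => g a b; rewrite linearP. Qed.

Definition coboundary (f : C) : dual A := Dual (coboundary_subproof f).

Definition cohomology_class (xi : dual A) : set (dual A) :=
  [set zeta | exists f, zeta = xi + coboundary f].

End SkewAlgebroid.

(* Nowhere vanishing sections of the [r]-th exterior power of the dual of the
   bundle with sections [L]. *)
Definition nonvanishing_form (R : realType) (n : nat) (M : manifold R n)
    (L : lmodType (Coo M)) r (w : ('I_r -> L) -> Coo M) :=
  alternating_form w /\ forall p : M, exists v, w v p != 0.

Section RelativeModularClass.
Context {R : realType} {n : nat} {M : manifold R n} (A B : skew_algebroid M).
Context (phi : {linear A -> B}).
Context (eta : ('I_(rank A) -> dual A) -> Coo M).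
Context (nu : ('I_(rank B) -> B) -> Coo M).

(* The tensor product of two forms [eta] and [nu] is the function
   [fun u v => eta u * nu v]. *)
Definition is_relative_modular_cocycle (xi : dual A) :=
  forall a u v, lie_multivector a eta u * nu v + eta u * lie_form (phi a) nu v =
                xi a * (eta u * nu v).

Definition relative_modular_cocycle : dual A :=
  xget 0 [set xi : dual A | is_relative_modular_cocycle xi].

Definition relative_modular_class : set (dual A) :=
  cohomology_class relative_modular_cocycle.

End RelativeModularClass.

Section Tangent.
Context {R : realType} {n : nat} (M : manifold R n).

Lemma lie_vfxx (X : vfield M) : lie_vf X X = 0.
Proof. by apply/val_inj/funext => f /=; rewrite subrr. Qed.

Lemma lie_vfDr (X Y Z : vfield M) : lie_vf X (Y + Z) = lie_vf X Y + lie_vf X Z.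
Proof.
apply/val_inj/funext => f /=; rewrite /vfield_fun /= !fctE.
have [XD _ _] := vfieldP X; rewrite [X in X - _]XD.
by rewrite opprD addrACA.
Qed.

Lemma lie_vfZr (X : vfield M) f (Y : vfield M) :
  lie_vf X (f *: Y) = f *: lie_vf X Y + X f *: Y.
Proof.
apply/val_inj/funext => g /=; rewrite /vfield_fun /= !fctE.
have [_ _ XM] := vfieldP X; rewrite [X in X - _]XM /GRing.scale /=.
by rewrite /vfield_fun; ring.
Qed.

Lemma vfieldDl (X Y : vfield M) f : (X + Y) f = X f + Y f.
Proof. by []. Qed.

Lemma vfieldZl f (X : vfield M) g : (f *: X) g = f * X g.
Proof. by []. Qed.

Lemma lie_vfC (X Y : vfield M) : lie_vf X Y = - lie_vf Y X.
Proof. by apply/val_inj/funext => f; rewrite /= fctE opprB. Qed.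

Lemma lie_vfDl (X Y Z : vfield M) : lie_vf (X + Y) Z = lie_vf X Z + lie_vf Y Z.
Proof. by rewrite lie_vfC lie_vfDr opprD -!lie_vfC. Qed.

Lemma lie_vfZl f (X Y : vfield M) :
  lie_vf (f *: X) Y = f *: lie_vf X Y - Y f *: X.
Proof. by rewrite lie_vfC lie_vfZr opprD -scalerN -lie_vfC. Qed.

Definition tangent : skew_algebroid M :=
  @SkewAlgebroid R n M (vfield M) n idfun (@lie_vf R n M) lie_vfxx lie_vfDr lie_vfZr.

End Tangent.

Section Divergence.
Context {R : realType} {n : nat} {M : manifold R n}.
Implicit Type mu : ('I_n -> vfield M) -> Coo M.

Definition volume_form mu := nonvanishing_form mu.

Definition orientable := exists mu, volume_form mu.

Definition divergence mu (X : vfield M) : Coo M :=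
  xget 0 [set g | forall Y, lie_form (A := tangent M) X mu Y = g * mu Y].

End Divergence.
Arguments orientable {R n} M.

(* A bivector field [pi] is represented by the skew bundle map [sharp pi]; as a
   bilinear form it is [fun alpha beta => beta (sharp pi alpha)]. *)
Record bivector (R : realType) (n : nat) (M : manifold R n) := Bivector {
  sharp :> {linear oneform M -> vfield M};
  sharp_skew : forall alpha : oneform M, alpha (sharp alpha) = 0 }.

Section Poisson.
Context {R : realType} {n : nat} {M : manifold R n}.
Implicit Types (alpha beta : oneform M) (f g h : Coo M) (X : vfield M).

Definition lie_oneform X alpha : oneform M := lie_dual (A := tangent M) X alpha.

Definition koszul (s : oneform M -> vfield M) alpha beta : oneform M :=
  lie_oneform (s alpha) beta - lie_oneform (s beta) alpha
    - ext_diff (beta (s alpha)).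

Lemma koszulE (s : oneform M -> vfield M) alpha beta X :
  koszul s alpha beta X =
  (s alpha (beta X) - beta (lie_vf (s alpha) X))
  - (s beta (alpha X) - alpha (lie_vf (s beta) X)) - X (beta (s alpha)).
Proof. by []. Qed.

Section Bivector.
Variable pi : bivector M.

Definition bivector_form alpha beta : Coo M := beta (pi alpha).

Definition poisson_bracket f g : Coo M := bivector_form (ext_diff f) (ext_diff g).

Definition hamiltonian h : vfield M := pi (ext_diff h).

Definition poisson := forall f g h,
  poisson_bracket f (poisson_bracket g h) +
  poisson_bracket g (poisson_bracket h f) +
  poisson_bracket h (poisson_bracket f g) = 0.

Definition poisson_vf X := forall alpha beta,
  X (bivector_form alpha beta) - bivector_form (lie_oneform X alpha) beta
    - bivector_form alpha (lie_oneform X beta) = 0.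

Definition poisson_class X : set (vfield M) :=
  [set Y | exists h, Y = X + hamiltonian h].

Definition H1_poisson : set (set (vfield M)) :=
  [set poisson_class X | X in poisson_vf].

(* The right-hand side is a derivation in [f] when [mu] is a volume form, so
   that the default value is not used. *)
Definition modular_vf mu : vfield M :=
  xget 0 [set X : vfield M | forall f, X f = divergence mu (hamiltonian f)].

Lemma bivector_form_skew alpha beta : beta (pi alpha) = - alpha (pi beta).
Proof.
apply/eqP; rewrite -addr_eq0; apply/eqP.
have := sharp_skew pi (alpha + beta).
by rewrite linearD !dualDr !dualDl !sharp_skew add0r addr0.
Qed.

Lemma koszulxx alpha : koszul pi alpha alpha = 0.
Proof.
apply/val_inj/funext => X; rewrite [LHS]koszulE subrr sub0r sharp_skew vfield0.
exact: oppr0.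
Qed.

Lemma koszulDr alpha beta gamma :
  koszul pi alpha (beta + gamma) = koszul pi alpha beta + koszul pi alpha gamma.
Proof.
apply/val_inj/funext => X.
have [XD _ _] := vfieldP X; have [aD _ _] := vfieldP (pi alpha).
rewrite [LHS]koszulE [RHS](_ : _ = koszul pi alpha beta X + koszul pi alpha gamma X) //.
rewrite !koszulE linearD !dualDl lie_vfDl dualDr XD aD vfieldDl; ring.
Qed.

Lemma koszulZr alpha f beta :
  koszul pi alpha (f *: beta) =
  f *: koszul pi alpha beta + pi alpha f *: beta.
Proof.
apply/val_inj/funext => X.
have [XD _ XM] := vfieldP X; have [aD _ aM] := vfieldP (pi alpha).
rewrite [LHS]koszulE [RHS](_ : _ = f * koszul pi alpha beta X + pi alpha f * beta X) //.
rewrite !koszulE linearZ !dualZl lie_vfZl dualDr dualZr XM aM vfieldZl.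
rewrite dualNr dualZr (bivector_form_skew alpha beta). ring.
Qed.

Definition cotangent : skew_algebroid M :=
  @SkewAlgebroid R n M (oneform M) n (sharp pi) (koszul pi)
    koszulxx koszulDr koszulZr.

(* The identification of vector fields with the sections of the dual of the
   cotangent bundle, i.e. with the 1-cochains of the cotangent algebroid. *)
Lemma eval_vf_subproof X : (fun alpha => alpha X) \in @linear_pred _ (oneform M).
Proof. by apply/asboolP. Qed.

Definition eval_vf X : dual cotangent := Dual (eval_vf_subproof X).

End Bivector.

Section Transpose.
Variable N : {linear vfield M -> vfield M}.

Lemma transpose_subproof alpha :
  (fun X => alpha (N X)) \in @linear_pred _ (vfield M).
Proof. by apply/asboolP => f X Y; rewrite linearP dual_is_linear. Qed.

Definition transpose alpha : oneform M := Dual (transpose_subproof alpha).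

Lemma transpose_linear : linear transpose.
Proof. by move=> f alpha beta; apply/val_inj/funext. Qed.

HB.instance Definition _ :=
  GRing.isLinear.Build (Coo M) (oneform M) (oneform M) *:%R transpose transpose_linear.

End Transpose.
End Poisson.

Record poisson_nijenhuis (R : realType) (n : nat) (M : manifold R n) :=
  PoissonNijenhuis {
    pi0 : bivector M;
    nij : {linear vfield M -> vfield M};
    pi0_poisson : poisson pi0;
    nij_torsion : forall X Y : vfield M,
      nij (lie_vf (nij X) Y) + nij (lie_vf X (nij Y))
        - nij (nij (lie_vf X Y)) - lie_vf (nij X) (nij Y) = 0;
    nij_sharp : forall alpha : oneform M,
      nij (pi0 alpha) = pi0 (transpose nij alpha);
    nij_koszul : forall alpha beta : oneform M,
      koszul (nij \o pi0) alpha beta =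
      koszul pi0 (transpose nij alpha) beta
        + koszul pi0 alpha (transpose nij beta)
        - transpose nij (koszul pi0 alpha beta) }.

Section PoissonNijenhuis.
Context {R : realType} {n : nat} {M : manifold R n} (P : poisson_nijenhuis M).

Lemma pi1_subproof (alpha : oneform M) : alpha ((nij P \o pi0 P) alpha) = 0.
Proof.
have /eqP : alpha (nij P (pi0 P alpha)) = - alpha (nij P (pi0 P alpha)).
  by rewrite {1}nij_sharp bivector_form_skew.
rewrite -addr_eq0 => /eqP H; apply/val_inj/funext => p.
have /(congr1 (fun f : Coo M => f p)) := H.
by rewrite /= fctE -mulr2n => /eqP; rewrite mulrn_eq0 => /eqP.
Qed.

Definition pi1 : bivector M := Bivector pi1_subproof.

Definition pn_modular_vf mu : vfield M :=
  modular_vf pi1 mu - nij P (modular_vf (pi0 P) mu).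

End PoissonNijenhuis.

(* Main.v *)
Require Import Defs.
From HB Require Import structures.
From mathcomp Require Import all_boot all_order all_algebra perm.
From mathcomp Require Import boolp classical_sets functions reals.
From mathcomp Require Import topology normedtype derive realfun.
From mathcomp Require Import constructive_ereal measure lebesgue_measure lebesgue_integral ftc.
From mathcomp Require Import sequences exp.
From mathcomp Require Import ring lra.

Set Implicit Arguments.
Unset Strict Implicit.
Unset Printing Implicit Defensive.
Import Order.TTheory GRing.Theory Num.Theory.
Import numFieldNormedType.Exports.

Local Open Scope classical_set_scope.
Local Open Scope ring_scope.

(** Both Lie algebroids live on the same bundle, and the two anchors are related by
[pi1 alpha = pi0 (N* alpha)]. The theorem is a trace computation in which this
relation makes almost everything cancel.

Fix a volume form [mu]. For vector fields [v = (v_1, ..., v_n)] put [m = mu v] and let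
[theta_i] be the one-form [mu (v_1, ..., _, ..., v_n)] with the argument in slot [i],
so that [theta_i (v_j) = m delta_ij]. For a bivector [pi], a one-form [alpha] and
[X = pi alpha], the trace of the Koszul bracket with [alpha] is
[sum_i [alpha, theta_i]_pi (v_i) = (n - 1) X m - m div X + 2 m alpha (X_mu)]
(lemma [koszul_traceE]): the difference of both sides is linear over the smooth
functions, vanishes on exact forms, and exact forms generate. Here the factor two
of the theorem appears. Subtracting the formula for [pi0] at [N* alpha] from the one for
[pi1] at [alpha], the terms in [X] and [div X] disappear because [X] is the same
vector field, and [2 m alpha (X_N)] is left. This is the relative modular cocycle up to
the logarithmic differential of the pairing of [eta] with [nu], which is a coboundary
(lemma [relative_modular_formP]); a coboundary of [f] is minus the evaluation at the
Hamiltonian vector field of [f], whence the equality of classes.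

That [X_N] is a Poisson vector field of [pi1] is checked on exact forms, where it says that
[X_N] is a derivation of the bracket of functions. For the modular vector field of
[pi1] this is the divergence of a commutator. For [N X0], with [X0] the modular vector field
of [pi0], it follows from [N* [alpha, beta]_1 = [N* alpha, N* beta]_0] and from [X0] being a
cocycle for [pi0].

What remains is to know that vector fields, which are derivations of the algebra of
smooth functions, behave like sections of a bundle of rank [n]. The geometric input is that
the value of a derivation at a point only sees the differential there
(lemma [vfield_vanishes], from the Hadamard lemma and bump functions). Hence
vector fields and functions satisfy the linear relations of an [n]-dimensional
space (lemma [vfield_combination]). Together with a volume form this is enough: a nonzero
smooth function stays nonzero after multiplication by some Jacobian determinant
[det (v_i f_j)] (lemma [exists_minor]), and an identity between smooth functions may
therefore be verified after multiplication by such determinants, where the fields [v_i]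
and the forms [d f_j] are generators. This yields generation by exact forms
(lemma [oneform_exact_generated]), the Cramer rule (lemma [volume_cramer]) and the
proportionality of top forms, hence divergences and modular vector fields. *)

(** * Regularity on open subsets of the space of row vectors *)

Section Lines.
Context {R : realType}.

Lemma is_derive_lineP (V W : normedModType R) (f : V -> W) (x v : V) (d : W) :
  is_derive x v f d <-> is_derive (0 : R) (1 : R) (fun t : R => f (t *: v + x)) d.
Proof.
have E : (fun h : R => h^-1 *: ((f \o shift x) (h *: v) - f x)) =
    (fun h : R => h^-1 *: (((fun t : R => f (t *: v + x)) \o shift (0 : R)) (h *: (1 : R))
      - f (0 *: v + x))).
  by apply/funext => h /=; rewrite addr0 scale0r add0r [_%:A]mulr1.
split=> -[cf df]; apply: DeriveDef; move: cf df; rewrite /derivable /derive.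
- by rewrite E.
- by rewrite E => _ ->.
- by rewrite -E.
- by rewrite -E => _ ->.
Qed.

End Lines.

Section Regularity.
Context {R : realType} {n : nat}.
Implicit Types (O U V : set 'rV[R]_n) (f g h : 'rV[R]_n -> R) (k : nat).

Lemma Ck_continuous k O g x : Ck k O g -> O x -> {for x, continuous g}.
Proof. by case: k => [|k] [cg _]; exact: cg. Qed.

Lemma Ck_subset k O U g : U `<=` O -> Ck k O g -> Ck k U g.
Proof.
move=> UO; elim: k g => [|k IH] g [cg Hg]; split=> //; try by move=> x /UO/cg.
move=> i.
have [dg Dg] := Hg i; split; last exact: IH.
by move=> x /UO; exact: dg.
Qed.

Lemma CkS_le1 k O g : Ck k.+1 O g -> Ck 1 O g.
Proof.
move=> [cg Hg]; split=> // i; have [dg Dg] := Hg i; split=> //; split=> // x.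
exact: Ck_continuous Dg.
Qed.

Lemma Ck_local k O g :
  (forall x, O x -> exists2 U, U x & Ck k U g) -> Ck k O g.
Proof.
elim: k g => [|k IH] g Og; split=> //.
- by move=> x /Og[U Ux [cg _]]; exact: cg.
- by move=> x /Og[U Ux [cg _]]; exact: cg.
move=> i; split=> [x /Og[U Ux [_ /(_ i)[dg _]]]|]; first exact: dg.
by apply: IH => x /Og[U Ux [_ /(_ i)[_ Dg]]]; exists U.
Qed.

Lemma smooth_on_partial O g i : smooth_on O g ->
  smooth_on O ('D_(delta_mx 0 i) g).
Proof. by move=> sg k; have [_ /(_ i)[]] := sg k.+1. Qed.

Lemma smooth_on_derivable O g i x : smooth_on O g -> O x ->
  derivable g x (delta_mx 0 i).
Proof. by move=> sg; have [_ /(_ i)[dg _]] := sg 1%N; exact: dg. Qed.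

Lemma Ck_sum k O (I : Type) (r : seq I) (F : I -> 'rV[R]_n -> R) : open O ->
  (forall i, Ck k O (F i)) -> Ck k O (fun x => \sum_(i <- r) F i x).
Proof.
move=> oO CF; elim: r => [|i r IH].
  apply: Ck_ext (Ck_cst k O (0 : R)) => // x _ /=; by rewrite big_nil.
apply: Ck_ext (CkD oO (CF i) IH) => // x _; by rewrite /= big_cons.
Qed.

Lemma is_derive_comp1 g (phi : R -> R) x v (a b : R) :
  is_derive x v g b -> is_derive (g x) (1 : R) phi a ->
  is_derive x v (phi \o g) (a * b).
Proof.
move=> dg dphi; apply/is_derive_lineP.
apply: (is_derive1_comp (f := phi) (g := fun t : R => g (t *: v + x))).
  by rewrite scale0r add0r.
exact: (proj1 (is_derive_lineP _ _ _ _) dg).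
Qed.

(** The derivatives of [phi] are only asked to exist along the values of [g], so that
the lemma also applies to functions such as the inverse and the logarithm. *)
Lemma Ck_comp1 k O g (phi psi : R -> R) : open O -> Ck k.+1 O g ->
  (forall x, O x -> is_derive (g x) (1 : R) phi (psi (g x))) ->
  Ck k O (psi \o g) -> Ck k.+1 O (phi \o g).
Proof.
move=> oO Cg dphi Cpsi; split=> [x Ox|i].
  apply: continuous_comp; first exact: Ck_continuous Cg Ox.
  by apply/differentiable_continuous/derivable1_diffP; case: (dphi _ Ox).
have [_ /(_ i)[dg Dg]] := Cg.
have D x : O x -> is_derive x (delta_mx 0 i) (phi \o g)
    (psi (g x) * 'D_(delta_mx 0 i) g x).
  by move=> Ox; apply: is_derive_comp1 (dphi x Ox); exact: derivableP (dg x Ox).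
split=> [x Ox|]; first by case: (D x Ox).
apply: Ck_ext (CkM oO Cpsi Dg) => // x Ox.
by case: (D x Ox) => _ ->.
Qed.

Lemma CkV k O g : open O -> (forall x, O x -> g x != 0) -> Ck k O g ->
  Ck k O (fun x => (g x)^-1).
Proof.
move=> oO g0; elim: k g g0 => [|k IH] g g0 Cg.
  by split=> // x Ox; apply: continuousV; [exact: g0|exact: Ck_continuous Cg Ox].
apply: (@Ck_comp1 _ _ _ (fun y => y^-1) (fun y => - (y ^-1 * y^-1))) => //.
  move=> x /g0 gx0; apply: DeriveDef; first exact: derivableV.
  by rewrite deriveV// derive_id scaleNr [_ *: _]mulr1 expr2 invfM.
have CV := IH _ g0 (CkS Cg).
apply: Ck_ext (CkM oO (Ck_cst k O (-1)) (CkM oO CV CV)) => // x Ox.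
by rewrite /= mulN1r.
Qed.

Lemma is_derive_coord (i j : 'I_n) (x : 'rV[R]_n) :
  is_derive x (delta_mx 0 i) (fun x : 'rV[R]_n => x 0 j) (i == j)%:R.
Proof.
apply/is_derive_lineP.
have -> : (fun t : R => (t *: delta_mx 0 i + x) 0 j) =
    (fun t => t * (i == j)%:R + x 0 j).
  by apply/funext => t; rewrite !mxE eqxx/= eq_sym.
apply: is_derive_eq.
by rewrite addr0 scaler0 add0r [_ *: _]mulr1.
Qed.

Lemma Ck_coord k O (j : 'I_n) : open O -> Ck k O (fun x : 'rV[R]_n => x 0 j).
Proof.
move=> oO; case: k => [|k]; split=> //; try by move=> x _; exact: coord_continuous.
move=> i; split=> [x _|]; first by case: (is_derive_coord i j x).
apply: Ck_ext (Ck_cst k O ((i == j)%:R : R)) => // x _.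
by case: (is_derive_coord i j x) => _ ->.
Qed.

End Regularity.

(** * Mean values, the chain rule and composition *)

Section MeanValue.
Context {R : realType} (V : normedModType R).

Lemma is_derive_line (f : V -> R) (x v : V) (t d : R) :
  is_derive (t *: v + x) v f d ->
  is_derive t (1 : R) (fun s : R => f (s *: v + x)) d.
Proof.
move=> /is_derive_lineP df; apply/is_derive_lineP.
suff -> : (fun s : R => f ((s *: (1 : R) + t) *: v + x)) =
          (fun s : R => f (s *: v + (t *: v + x))) by [].
by apply/funext => s; rewrite [s *: 1]mulr1 scalerDl addrA.
Qed.

Lemma mean_value_line (f : V -> R) (x v : V) (a : R) :
  (forall c, `|c| <= `|a| -> derivable f (c *: v + x) v) ->
  exists2 c, `|c| <= `|a| & f (a *: v + x) - f x = a * 'D_v f (c *: v + x).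
Proof.
move=> df; pose phi (t : R) := f (t *: v + x).
have dphi c : `|c| <= `|a| -> is_derive c (1 : R) phi ('D_v f (c *: v + x)).
  by move=> /df dfc; apply/is_derive_line/derivableP.
have cphi c : `|c| <= `|a| -> {for c, continuous phi}.
  move=> /dphi [dc _]; exact/differentiable_continuous/derivable1_diffP.
have phi0 : phi 0 = f x by rewrite /phi scale0r add0r.
have [a0|a0] := leP 0 a.
  have I t : t \in `[0, a] -> `|t| <= `|a|.
    by rewrite in_itv/= => /andP[t0 ta]; rewrite !ger0_norm.
  have [|c cI E] := MVT_segment a0 (fun t ti => dphi t (I t (subset_itv_oo_cc ti))).
    apply: continuous_in_subspaceT => t; rewrite inE/= => /I; exact: cphi.
  by exists c; [exact: I|rewrite -phi0 E subr0 mulrC].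
have I t : t \in `[a, 0] -> `|t| <= `|a|.
  by rewrite in_itv/= => /andP[at0 t0]; rewrite !ler0_norm ?lerN2// ltW.
have [|c cI E] := MVT_segment (ltW a0) (fun t ti => dphi t (I t (subset_itv_oo_cc ti))).
  apply: continuous_in_subspaceT => t; rewrite inE/= => /I; exact: cphi.
exists c; first exact: I.
by rewrite -phi0 -[LHS]opprB E sub0r mulrN opprK mulrC.
Qed.

End MeanValue.

Section ChainRule.
Context {R : realType} {n : nat}.
Implicit Types (H : 'rV[R]_n -> R) (x y : 'rV[R]_n).

(** The points [mix y0 k y] interpolate between [y0] and [y] one coordinate at a time,
so that consecutive ones lie on a line parallel to an axis and the mean value theorem
in one variable applies to them. *)
Definition mix y0 (k : nat) y : 'rV[R]_n :=
  \row_j (if (j < k)%N then y 0 j else y0 0 j).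

Lemma mixS y0 (k : 'I_n) y :
  mix y0 k.+1 y = (y 0 k - y0 0 k) *: delta_mx 0 k + mix y0 k y.
Proof.
apply/rowP => j; rewrite !mxE eqxx/= ltnS leq_eqVlt.
have [-> | jk] := eqVneq j k.
  by rewrite eqxx ltnn mulr1 subrK.
by rewrite -val_eqE /= in jk; rewrite (negPf jk) mulr0 add0r.
Qed.

Lemma mix0 y0 y : mix y0 0 y = y0. Proof. by apply/rowP => j; rewrite !mxE. Qed.

Lemma mixn y0 y : mix y0 n y = y.
Proof. by apply/rowP => j; rewrite !mxE ltn_ord. Qed.

Lemma ball_mix y0 (k : 'I_n) y (r c : R) : ball y0 r y ->
  `|c| <= `|y 0 k - y0 0 k| -> ball y0 r (c *: delta_mx 0 k + mix y0 k y).
Proof.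
move=> [r0 yr] ck; split=> // i j; rewrite (ord1 i) !mxE eqxx/=.
have [-> | jk] := eqVneq j k.
  rewrite ltnn mulr1 /ball/= opprD addrCA subrr addr0 normrN.
  by apply: le_lt_trans ck _; rewrite distrC; exact: yr.
rewrite mulr0 add0r; case: ifP => _; first exact: yr.
by rewrite /ball/= subrr normr0.
Qed.

(** The slopes turn an increment of [H] into an exact linear combination of the coordinate
increments; their convergence to the partial derivatives replaces Frechet differentiability in the
chain rule. *)
Definition slope H y0 (j : 'I_n) y : R :=
  if y 0 j == y0 0 j then 'D_(delta_mx 0 j) H y0
  else (H (mix y0 j.+1 y) - H (mix y0 j y)) / (y 0 j - y0 0 j).

(** Telescoping along the points [mix y0 k y]. *)
Lemma slopeE H y0 y : H y - H y0 = \sum_j (y 0 j - y0 0 j) * slope H y0 j y.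
Proof.
transitivity (\sum_(j < n) (H (mix y0 j.+1 y) - H (mix y0 j y))).
  by rewrite -(big_mkord xpredT (fun j => H (mix y0 j.+1 y) - H (mix y0 j y)))
    telescope_sumr// mix0 mixn.
apply: eq_bigr => j _; rewrite /slope mixS.
have [->|yj] := eqVneq; first by rewrite subrr scale0r add0r mul0r subrr.
by rewrite mulrCA mulfV ?mulr1// subr_eq0.
Qed.

Lemma slope_cvg H y0 j :
  (\forall y \near y0, derivable H y (delta_mx 0 j)) ->
  {for y0, continuous ('D_(delta_mx 0 j) H)} ->
  slope H y0 j y @[y --> y0] --> 'D_(delta_mx 0 j) H y0.
Proof.
move=> dH cH; apply: (proj2 (@cvgrPdist_lt _ _ _ _ (nbhs_filter y0) _ _)) => e e0.
have cHe : \forall y \near y0, `|'D_(delta_mx 0 j) H y0 - 'D_(delta_mx 0 j) H y| < e.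
  exact: (proj1 (@cvgrPdist_lt _ _ _ _ (nbhs_filter y0) _ _) cH e e0).
have : \forall y \near y0, derivable H y (delta_mx 0 j) /\
    `|'D_(delta_mx 0 j) H y0 - 'D_(delta_mx 0 j) H y| < e.
  by near=> y; split; near: y.
move/nbhs_ballP => [r /= r0 Hr].
apply/nbhs_ballP; exists r => //= y yr; rewrite /slope.
have [_|yj] := eqVneq; first by rewrite subrr normr0.
have B c ck := Hr _ (@ball_mix y0 j y r c yr ck).
have [|c cj] := @mean_value_line _ _ H (mix y0 j y) (delta_mx 0 j) (y 0 j - y0 0 j).
  by move=> c /B[].
rewrite -mixS => ->; rewrite mulrAC mulfV ?subr_eq0// mul1r.
by have [] := B c cj.
Unshelve. all: by end_near. Qed.

(** Chain rule along a curve, from continuity of the partial derivatives at the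
point: by [slopeE] the difference quotient is a sum of products of slopes and difference quotients of
the coordinates of the curve. *)
Lemma is_derive_comp_partial (H : 'rV[R]_n -> R) (T : R -> 'rV[R]_n) t (dT : 'I_n -> R) :
  (forall j, \forall y \near T t, derivable H y (delta_mx 0 j)) ->
  (forall j, {for T t, continuous ('D_(delta_mx 0 j) H)}) ->
  (forall j, is_derive t (1 : R) (fun s => T s 0 j) (dT j)) ->
  is_derive t (1 : R) (H \o T) (\sum_j 'D_(delta_mx 0 j) H (T t) * dT j).
Proof.
move=> dH cH dTt.
have cT : {for t, continuous T}.
  apply: differentiable_continuous; apply/derivable1_diffP/derivable_mxP => i j.
  by rewrite (ord1 i); case: (dTt j).
have L : h^-1 *: (((H \o T) \o shift t) (h *: (1 : R)) - (H \o T) t) @[h --> 0^'] -->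
    \sum_j 'D_(delta_mx 0 j) H (T t) * dT j.
  have -> : (fun h : R => h^-1 *: (((H \o T) \o shift t) (h *: (1 : R)) - (H \o T) t)) =
     (fun h : R => \sum_j slope H (T t) j (T (h *: 1 + t)) *
           (h^-1 *: ((fun s => T s 0 j) (h *: 1 + t) - T t 0 j))).
    apply/funext => h; rewrite /= slopeE scaler_sumr; apply: eq_bigr => j _.
    by rewrite /GRing.scale/=; ring.
  apply: cvg_big => [|j _]; first exact: add_continuous.
  apply: cvgM.
    have ch : T (h *: (1 : R) + t) @[h --> 0^'] --> T t.
      apply: (@cvg_comp _ _ _ (fun h : R => h *: (1 : R) + t) T _ (nbhs t)); last exact: cT.
      have /= : {for (0 : R), continuous (fun h : R => h *: (1 : R) + t)}.
        by apply: differentiable_continuous.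
      rewrite /prop_for /continuous_at scale0r add0r => c0.
      by apply: cvg_trans c0; apply: cvg_app; exact: cvg_within.
    exact: (cvg_comp _ _ ch (slope_cvg (dH j) (cH j))).
  have [dTj <-] := dTt j; exact: dTj.
by apply: DeriveDef; [apply/cvg_ex; eexists; exact: L|exact/cvg_lim].
Qed.

End ChainRule.

Section Composition.
Context {R : realType} {m n : nat}.

Lemma row_continuous (T : 'rV[R]_m -> 'rV[R]_n) x :
  (forall j, {for x, continuous (fun y => T y 0 j)}) -> {for x, continuous T}.
Proof.
move=> cT; apply: (proj2 (@cvgrPdist_lt _ _ _ _ (nbhs_filter x) _ _)) => e e0.
near=> y; rewrite [ltLHS]/Num.Def.normr/= mx_normrE.
apply/bigmax_ltP; split=> //= -[i j] _; rewrite (ord1 i) !mxE/=.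
move: j; near: y; apply: filter_forall => j.
exact: (proj1 (@cvgrPdist_lt _ _ _ _ (nbhs_filter x) _ _) (cT j) e e0).
Unshelve. all: by end_near. Qed.

Lemma is_derive_comp (H : 'rV[R]_n -> R) (T : 'rV[R]_m -> 'rV[R]_n) x (i : 'I_m)
    (O : set 'rV[R]_n) : open O -> O (T x) -> Ck 1 O H ->
  (forall j, derivable (fun y => T y 0 j) x (delta_mx 0 i)) ->
  is_derive x (delta_mx 0 i) (H \o T)
    (\sum_j 'D_(delta_mx 0 j) H (T x) * 'D_(delta_mx 0 i) (fun y => T y 0 j) x).
Proof.
move=> oO OTx [_ CH] dT; apply/is_derive_lineP.
have x0 : (0 : R) *: delta_mx 0 i + x = x by rewrite scale0r add0r.
pose S (t : R) := T (t *: delta_mx 0 i + x).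
have S0 : S 0 = T x by rewrite /S x0.
rewrite -S0; apply: (@is_derive_comp_partial _ _ H S 0) => j; rewrite ?S0.
- apply: (filterS (fun y Oy => (CH j).1 y Oy)); exact: open_nbhs_nbhs.
- exact: (CH j).2.1 _ OTx.
- apply: (@is_derive_line _ _ (fun y => T y 0 j)); rewrite x0; exact: derivableP.
Qed.

Lemma Ck_comp k (U : set 'rV[R]_m) (O : set 'rV[R]_n)
    (H : 'rV[R]_n -> R) (T : 'rV[R]_m -> 'rV[R]_n) :
  open U -> open O -> (forall x, U x -> O (T x)) ->
  (forall j, Ck k U (fun x => T x 0 j)) -> Ck k O H -> Ck k U (H \o T).
Proof.
move=> oU oO UO; elim: k H => [|k IH] H CT CH.
  split=> // x Ux; apply: continuous_comp; last exact: Ck_continuous CH (UO x Ux).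
  by apply: row_continuous => j; exact: Ck_continuous (CT j) Ux.
have D x i (Ux : U x) := is_derive_comp oO (UO x Ux)
  (CkS_le1 CH) (fun j => ((CT j).2 i).1 x Ux).
split=> [x Ux|i].
  apply: continuous_comp; last exact: Ck_continuous CH (UO x Ux).
  by apply: row_continuous => j; exact: Ck_continuous (CT j) Ux.
split=> [x Ux|]; first by case: (D x i Ux).
apply: Ck_ext (Ck_sum (index_enum 'I_n) oU (fun j => CkM oU
    (IH _ (fun j => CkS (CT j)) (CH.2 j).2) ((CT j).2 i).2)) => // x Ux.
by case: (D x i Ux) => _ ->.
Qed.

End Composition.

(** * Integration over the unit interval *)

Section UnitIntegral.
Context {R : realType}.
Implicit Types (f g : R -> R).

Definition cont01 f := forall t, 0 <= t <= 1 -> {for t, continuous f}.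

Definition int01 f : R := (\int[@lebesgue_measure R]_(t in `[0, 1]) f t)%R.

Lemma cont01_within f : cont01 f -> {within `[0, 1], continuous f}.
Proof.
by move=> cf; apply: continuous_in_subspaceT => t; rewrite inE/= in_itv => /cf.
Qed.

Lemma cont01_integrable f : cont01 f ->
  (@lebesgue_measure R).-integrable `[0, 1] (EFin \o f).
Proof.
move=> cf; apply: continuous_compact_integrable; first exact: segment_compact.
exact: cont01_within.
Qed.

Lemma int01_cst (c : R) : int01 (fun=> c) = c.
Proof.
by rewrite /int01 Rintegral_cst//= lebesgue_measure_itv/= lte_fin ltr01 -EFinB/= subr0 mulr1.
Qed.

Lemma int01B f g : cont01 f -> cont01 g ->
  int01 (fun t => f t - g t) = int01 f - int01 g.
Proof. by move=> cf cg; apply: RintegralB => //; exact: cont01_integrable. Qed.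

Lemma int01D f g : cont01 f -> cont01 g ->
  int01 (fun t => f t + g t) = int01 f + int01 g.
Proof. by move=> cf cg; apply: RintegralD => //; exact: cont01_integrable. Qed.

Lemma int01Z (c : R) f : cont01 f -> int01 (fun t => c * f t) = c * int01 f.
Proof. by move=> cf; apply: RintegralZl => //; exact: cont01_integrable. Qed.

Lemma eq_int01 f g : (forall t, 0 <= t <= 1 -> f t = g t) -> int01 f = int01 g.
Proof.
by move=> fg; apply: eq_Rintegral => t; rewrite inE/= in_itv => /fg.
Qed.

Lemma norm_int01_le f e : cont01 f -> (forall t, 0 <= t <= 1 -> `|f t| <= e) ->
  `|int01 f| <= e.
Proof.
move=> cf fe; apply: le_trans (le_normr_Rintegral _ (cont01_integrable cf)) _ => //.
rewrite -[leRHS]int01_cst; apply: le_Rintegral => //.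
- apply: cont01_integrable => t t01.
  by apply: continuous_comp; [exact: cf|exact: norm_continuous].
- by apply: cont01_integrable => t t01; exact: cst_continuous.
Qed.

Lemma int01_derive f g : cont01 g ->
  (forall t : R, 0 <= t <= 1 -> is_derive t (1 : R) f (g t)) ->
  int01 g = f 1 - f 0.
Proof.
move=> cg df; rewrite /int01 /Rintegral.
have cf t : 0 <= t <= 1 -> {for t, continuous f}.
  by move=> /df[dft _]; exact/differentiable_continuous/derivable1_diffP.
have := @continuous_FTC2 R g f 0 1 ltr01 (cont01_within cg).
move=> -> //.
- split.
  + by move=> t /=; rewrite in_itv/= => /andP[/ltW t0 /ltW t1]; case: (df t) => //; rewrite t0 t1.
  + by apply: cvg_at_right_filter; apply: cf; rewrite lexx ler01.
  + by apply: cvg_at_left_filter; apply: cf; rewrite lexx ler01.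
- move=> t; rewrite in_itv/= => /andP[/ltW t0 /ltW t1].
  by rewrite derive1E; case: (df t) => //; rewrite t0 t1.
Qed.

Lemma int01_sum (I : Type) (s : seq I) (c : I -> R) (F : I -> R -> R) :
  (forall i, cont01 (F i)) ->
  cont01 (fun t => \sum_(i <- s) c i * F i t) /\
  int01 (fun t => \sum_(i <- s) c i * F i t) = \sum_(i <- s) c i * int01 (F i).
Proof.
move=> cF; have cM i : cont01 (fun t => c i * F i t).
  by move=> t t01; apply: cvgM; [exact: cvg_cst|exact: cF].
elim: s => [|i s [cs IH]].
  split; last first.
    by rewrite big_nil -[RHS]int01_cst; apply: eq_int01 => t _; rewrite big_nil.
  rewrite (_ : (fun _ => _) = cst 0); first by move=> t _; exact: cst_continuous.
  by apply/funext => t; rewrite big_nil.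
have -> : (fun t => \sum_(j <- i :: s) c j * F j t) =
    (fun t => c i * F i t + \sum_(j <- s) c j * F j t).
  by apply/funext => t; rewrite big_cons.
split; first by move=> t t01; apply: cvgD; [exact: cM|exact: cs].
by rewrite big_cons int01D// int01Z// IH.
Qed.

End UnitIntegral.

(** * Radial means and the Hadamard lemma *)

Section Radial.
Context {R : realType} {n : nat}.
Implicit Types (f g : 'rV[R]_n -> R) (x y : 'rV[R]_n).

(** The tube lemma, from compactness of the unit interval. *)
Lemma near_unit_interval (S : topologicalType) (p0 : S) (P : S -> R -> Prop) :
  (forall t : R, 0 <= t <= 1 -> \forall z \near (t, p0), P z.2 z.1) ->
  \forall p \near p0, forall t : R, 0 <= t <= 1 -> P p t.
Proof.
move=> HP; have /compact_near_coveringP K := @segment_compact R 0 1.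
have H := K S (nbhs p0) P (nbhs_filter p0).
apply: filterS (H _) => [p Pp t t01|t]; first by apply: Pp; rewrite /= in_itv.
by rewrite /= in_itv => /HP.
Qed.

Lemma near_unit_interval_dist (S : topologicalType) (p0 : S)
    (phi : R * S -> 'rV[R]_n) g (e : R) : 0 < e ->
  (forall t : R, 0 <= t <= 1 -> {for (t, p0), continuous phi}) ->
  (forall t : R, 0 <= t <= 1 -> {for phi (t, p0), continuous g}) ->
  \forall p \near p0, forall t : R, 0 <= t <= 1 ->
    `|g (phi (t, p)) - g (phi (t, p0))| < e.
Proof.
move=> e0 cphi cg.
apply: (@near_unit_interval S p0 (fun p t => `|g (phi (t, p)) - g (phi (t, p0))| < e)).
move=> t t01.
have c : {for (t, p0), continuous (g \o phi)}.
  by apply: continuous_comp; [exact: cphi|exact: cg].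
have e20 : 0 < e / 2 by rewrite divr_gt0.
(* The product neighbourhood also contains the pairs [(t', p0)]. *)
have [[A B] /= [nA nB] AB] := proj1 (@cvgrPdist_lt _ _ _ _ (nbhs_filter (t, p0)) _ _) c _ e20.
exists (A, B) => //= -[t' p] /= [At' Bp].
have := AB (t', p) (conj At' Bp); have := AB (t', p0) (conj At' (nbhs_singleton nB)).
rewrite /= => h1 h2; rewrite [e]splitr.
rewrite -(subrKA (g (phi (t, p0)))); apply: le_lt_trans (ler_normD _ _) _.
by apply: ltrD => //; rewrite distrC.
Qed.

Variables (x0 : 'rV[R]_n) (r : R).
Local Notation B := (ball x0 r).

Definition segment_point (t : R) x := t *: (x - x0) + x0.

(** The exponent makes this family of operators stable under partial derivatives: a
derivative of the mean of order [m] is the mean of order [m + 1] of a derivative. Smoothness of the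
coefficients in the Hadamard lemma is a consequence. *)
Definition radial_mean (m : nat) f x : R :=
  int01 (fun t => t ^+ m * f (segment_point t x)).

Lemma ball_segment_point t x : B x -> 0 <= t <= 1 -> B (segment_point t x).
Proof.
move=> [r0 Bx] /andP[t0 t1]; split=> // i j; rewrite !mxE.
rewrite /ball/= opprD addrCA subrr addr0 normrN normrM ger0_norm//.
have := Bx i j; rewrite /ball/= distrC; apply: le_lt_trans.
by rewrite ler_piMl.
Qed.

Lemma segment_point_continuous : continuous (fun z : R * 'rV[R]_n => segment_point z.1 z.2).
Proof.
move=> z; have FF := nbhs_filter z.
apply: (@cvgD _ _ _ _ FF (fun z : R * 'rV[R]_n => z.1 *: (z.2 - x0)) (cst x0)); last exact: cvg_cst.
apply: (@cvgZ _ _ _ _ FF); first exact: cvg_fst.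
apply: (@cvgB _ _ _ _ FF (fun z : R * 'rV[R]_n => z.2) (cst x0)); first exact: cvg_snd.
exact: cvg_cst.
Qed.

Lemma segment_point0 t : segment_point t x0 = x0.
Proof. by rewrite /segment_point subrr scaler0 add0r. Qed.

Lemma segment_point1 x : segment_point 1 x = x.
Proof. by rewrite /segment_point scale1r subrK. Qed.

Lemma segment_point_shift t h v x :
  segment_point t (h *: v + x) = (t * h) *: v + segment_point t x.
Proof. by rewrite /segment_point -addrA scalerDr scalerA addrA. Qed.

Lemma cont01_radial m f x : (forall y, B y -> {for y, continuous f}) -> B x ->
  cont01 (fun t => t ^+ m * f (segment_point t x)).
Proof.
move=> cf Bx t t01.
have ct : {for t, continuous (fun s : R => f (segment_point s x))}.
  apply: (@continuous_comp _ _ _ (fun s : R => segment_point s x) f); last first.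
    by apply: cf; exact: ball_segment_point.
  have FF := nbhs_filter t.
  apply: (@cvgD _ _ _ (nbhs t) FF (fun s : R => s *: (x - x0)) (cst x0)); last exact: cvg_cst.
  apply: (@cvgZr_tmp _ _ _ (nbhs t) FF id); exact: cvg_id.
exact: (cvgM (@exprn_continuous R m t) ct).
Qed.

Lemma radial_mean_continuous m f x : (forall y, B y -> {for y, continuous f}) -> B x ->
  {for x, continuous (radial_mean m f)}.
Proof.
move=> cf Bx; apply: (proj2 (@cvgrPdist_le _ _ _ _ (nbhs_filter x) _ _)) => e e0.
have N := @near_unit_interval_dist _ x (fun z => segment_point z.1 z.2) f e e0
  (fun t _ => @segment_point_continuous (t, x))
  (fun t t01 => cf _ (ball_segment_point Bx t01)).
have NB : \forall y \near x, B y.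
  by apply: open_nbhs_nbhs; split => //; exact: ball_open.
apply: filterS2 N NB => y Hy By.
rewrite /radial_mean -int01B; [|exact: cont01_radial..].
apply: norm_int01_le => [t t01|t t01].
  by apply: continuousB; exact: cont01_radial.
rewrite -mulrBr normrM -[leRHS]mul1r ler_pM//; last by rewrite distrC ltW// Hy.
by case/andP: t01 => t0 t1; rewrite ger0_norm ?exprn_ge0// exprn_ile1.
Qed.

(** Differentiation under the integral sign. By the mean value theorem the difference quotient
of the integrand differs from its expected limit by an increment of the partial derivative, which is small
uniformly on the segment. *)
Lemma radial_mean_derive m f x i : Ck 1 B f -> B x ->
  is_derive x (delta_mx 0 i) (radial_mean m f) (radial_mean m.+1 ('D_(delta_mx 0 i) f) x).
Proof.
move=> [cf /(_ i)[df [cg _]]] Bx; set g := 'D_(delta_mx 0 i) f in cg *.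
pose phi (z : R * R) : 'rV[R]_n := z.2 *: delta_mx 0 i + segment_point z.1 x.
have cphi z : {for z, continuous phi}.
  have FF := nbhs_filter z.
  apply: (@cvgD _ _ _ (nbhs z) FF (fun z : R * R => z.2 *: (delta_mx 0 i : 'rV[R]_n))).
    by apply: (@cvgZr_tmp _ _ _ (nbhs z) FF snd); exact: cvg_snd.
  apply: (@cvgD _ _ _ (nbhs z) FF (fun z : R * R => z.1 *: (x - x0)) (cst x0)); last exact: cvg_cst.
  apply: (@cvgZr_tmp _ _ _ (nbhs z) FF fst); exact: cvg_fst.
have phi0 t : phi (t, 0) = segment_point t x by rewrite /phi scale0r add0r.
suff L : h^-1 *: ((radial_mean m f \o shift x) (h *: delta_mx 0 i) - radial_mean m f x)
    @[h --> 0^'] --> radial_mean m.+1 g x.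
  by apply: DeriveDef; [apply/cvg_ex; eexists; exact: L|exact/cvg_lim].
apply/cvgrPdist_le => e e0.
have Bseg t : 0 <= t <= 1 -> B (segment_point t x) by exact: ball_segment_point.
(* Short translates of the segment from the centre to [x] stay in the ball, uniformly in [t]. *)
have N1 : \forall c \near (0 : R), forall t, 0 <= t <= 1 -> B (phi (t, c)).
  apply: (@near_unit_interval _ _ (fun c t => B (phi (t, c)))) => t t01.
  have : nbhs (phi (t, 0)) B.
    by rewrite phi0; apply: open_nbhs_nbhs; split; [exact: ball_open|exact: Bseg].
  by move=> /(cphi (t, 0)); apply: filterS => -[].
have N2 : \forall c \near (0 : R), forall t, 0 <= t <= 1 ->
    `|g (phi (t, c)) - g (phi (t, 0))| < e.
  apply: near_unit_interval_dist => // t t01.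
  by rewrite phi0; apply: cg; exact: Bseg.
have [d /= d0 Hd] : \forall c \near (0 : R), (forall t, 0 <= t <= 1 -> B (phi (t, c))) /\
   (forall t, 0 <= t <= 1 -> `|g (phi (t, c)) - g (phi (t, 0))| < e).
  by apply: filterS2 N1 N2.
have Bphi c t : `|c| < d -> 0 <= t <= 1 -> B (phi (t, c)).
  by move=> cd; apply: (Hd c _).1; rewrite /= sub0r normrN.
have gphi c t : `|c| < d -> 0 <= t <= 1 -> `|g (phi (t, c)) - g (phi (t, 0))| < e.
  by move=> cd; apply: (Hd c _).2; rewrite /= sub0r normrN.
exists d => //= h; rewrite /ball_/= sub0r normrN => hd h0.
have Bh : B (h *: delta_mx 0 i + x).
  by have := Bphi h 1 hd; rewrite /phi/= segment_point1; apply; rewrite ler01 lexx.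
have E t : 0 <= t <= 1 -> exists2 c, `|c| <= `|h| &
   h^-1 * (t ^+ m * f (segment_point t (h *: delta_mx 0 i + x)) - t ^+ m * f (segment_point t x))
     = t ^+ m.+1 * g (phi (t, c)).
  move=> t01; have th : `|t * h| <= `|h|.
    by case/andP: t01 => t0 t1; rewrite normrM ger0_norm// ler_piMl.
  have [c ct Ec] := @mean_value_line _ _ f (segment_point t x) (delta_mx 0 i) (t * h)
     (fun c ch => df _ (Bphi c t (le_lt_trans (le_trans ch th) hd) t01)).
  exists c; first exact: le_trans ct th.
  rewrite -mulrBr segment_point_shift Ec /phi/= exprSr.
  by rewrite -[derive f _ _]/(g _); move: (g _) => gc; field.
rewrite [X in `|_ - X|](_ : _ = int01 (fun t => h^-1 * (t ^+ m * f (segment_point t (h *: delta_mx 0 i + x)) - t ^+ m * f (segment_point t x)))); last first.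
  rewrite int01Z ?int01B //; try exact: cont01_radial.
  by move=> t t01; apply: continuousB; exact: cont01_radial.
rewrite /radial_mean -int01B; first last.
- move=> t t01; apply: continuousM; first exact: cst_continuous.
  by apply: continuousB; exact: cont01_radial.
- exact: cont01_radial.
apply: norm_int01_le => [t t01|t t01].
  apply: continuousB; first exact: cont01_radial.
  apply: continuousM; first exact: cst_continuous.
  by apply: continuousB; exact: cont01_radial.
have [c ch ->] := E t t01.
rewrite -mulrBr normrM -[leRHS]mul1r ler_pM//.
  by case/andP: t01 => t0 t1; rewrite ger0_norm ?exprn_ge0// exprn_ile1.
have := gphi c t (le_lt_trans ch hd) t01.
by rewrite phi0 distrC; exact: ltW.
Qed.

Lemma Ck_radial_mean k m f : Ck k B f -> Ck k B (radial_mean m f).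
Proof.
elim: k m f => [|k IH] m f Cf.
  by split=> // x Bx; apply: radial_mean_continuous => // y; exact: (Ck_continuous Cf).
have D x i (Bx : B x) := radial_mean_derive m i (CkS_le1 Cf) Bx.
split=> [x Bx|i].
  by apply: radial_mean_continuous => // y; exact: (Ck_continuous Cf).
split=> [x Bx|]; first by case: (D x i Bx).
apply: Ck_ext (IH m.+1 _ (Cf.2 i).2) => [|x Bx]; first exact: ball_open.
by case: (D x i Bx) => _ ->.
Qed.

Lemma radial_mean_center f : radial_mean 0 f x0 = f x0.
Proof.
rewrite -[RHS]int01_cst; apply: eq_int01 => t _.
by rewrite segment_point0 expr0 mul1r.
Qed.

(** Integrate the derivative of [f] along the segment from the centre to [x]. *)
Lemma hadamard f x : Ck 1 B f -> B x ->
  f x - f x0 = \sum_i (x 0 i - x0 0 i) * radial_mean 0 ('D_(delta_mx 0 i) f) x.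
Proof.
move=> Cf Bx; have [cf Df] := Cf.
pose G i t := 'D_(delta_mx 0 i) f (segment_point t x).
have G0 i : (fun t => t ^+ 0 * G i t) = G i.
  by apply/funext => t; rewrite expr0 mul1r.
have cG i : cont01 (G i).
  by rewrite -G0; exact: (cont01_radial (fun y By => (Df i).2.1 y By) Bx).
pose F t := f (segment_point t x).
have -> : f x - f x0 = F 1 - F 0.
  by rewrite /F segment_point1 /segment_point scale0r add0r.
have [cS ES] := int01_sum (index_enum 'I_n) (fun i => x 0 i - x0 0 i) cG.
have <- : int01 (fun t => \sum_i (x 0 i - x0 0 i) * G i t) = F 1 - F 0.
  apply: int01_derive => // t t01; have BB := ball_segment_point Bx t01.
  under eq_bigr do rewrite mulrC.
  apply: (@is_derive_comp_partial _ _ f (fun t => segment_point t x)) => j.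
  - apply: (filterS (fun y By => (Df j).1 y By)); apply: open_nbhs_nbhs.
    by split => //; exact: ball_open.
  - exact: (Df j).2.1.
  - have -> : (fun s : R => segment_point s x 0 j) = (fun s => s * (x 0 j - x0 0 j) + x0 0 j).
      by apply/funext => s; rewrite !mxE.
    apply: is_derive_eq.
    by rewrite addr0 scaler0 add0r [_ *: _]mulr1.
by rewrite ES; apply: eq_bigr => i _; rewrite /radial_mean -/(G i) G0.
Qed.

End Radial.

(** * Bump functions *)

Section FlatFunction.
Context {R : realType}.

(** The functions [t^-m exp (- 1 / t)], extended by [0] to [t <= 0], are closed under
differentiation up to linear combinations; this is how the smoothness of [exp (- 1 / t)] at the origin
is obtained. *)
Definition flat (m : nat) (t : R) : R :=
  if 0 < t then t^-1 ^+ m * expR (- t^-1) else 0.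

Definition dflat (m : nat) (t : R) : R := flat m.+2 t - m%:R * flat m.+1 t.

Lemma flatS m (t : R) : t != 0 -> t^-1 * flat m t = flat m.+1 t.
Proof. by rewrite /flat; case: ifP => _ t0; rewrite ?mulr0// mulrA exprS. Qed.

(** The exponential series dominates each of its terms: [u ^ (m + 1) <= (m + 1)! exp u], for
[u = 1 / t]. *)
Lemma norm_flat_le m (t : R) : `|flat m t| <= (m.+1)`!%:R * `|t|.
Proof.
rewrite /flat; case: ifPn => [t0|_]; last by rewrite normr0 mulr_ge0.
have u0 : 0 < t^-1 by rewrite invr_gt0.
rewrite !ger0_norm ?mulr_ge0 ?exprn_ge0 ?expR_ge0 ?(ltW u0) ?(ltW t0)//.
rewrite expRN ler_pdivrMr ?expR_gt0//.
have := expR_ge1Dxn m (ltW u0); rewrite -(ler_pM2r t0) mulrDl => H.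
have {H} : t^-1 ^+ m.+1 / (m.+1)`!%:R * t <= expR t^-1 * t.
  by apply: le_trans H; rewrite lerDr mul1r ltW.
rewrite mulrAC ler_pdivrMr ?ltr0n ?fact_gt0// exprSr divfK ?gt_eqF//.
by rewrite [leRHS]mulrC [expR _ * t]mulrC mulrA.
Qed.

Lemma is_derive_flat m (t : R) : is_derive t (1 : R) (flat m) (dflat m t).
Proof.
have [t0|t0|->] := ltgtP t 0.
- apply: (near_eq_is_derive (f := cst 0)).
  + near=> s; rewrite /flat ifN// -leNgt ltW//; near: s; exact: lt_nbhsl.
  + by rewrite /dflat /flat !ifN ?mulr0 ?subr0 -?leNgt ?ltW//; exact: is_derive_cst.
- apply: (near_eq_is_derive (f := fun s : R => s^-1 ^+ m * expR (- s^-1) : R)).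
  + near=> s; rewrite /flat ifT//; near: s; exact: lt_nbhsr.
  + have tn0 : t != 0 by rewrite gt_eqF.
    have dV : is_derive t (1 : R) (fun s : R => s^-1) (- (t^-1 ^+ 2)).
      apply: is_derive_eq; first exact: is_deriveV.
      by rewrite [LHS]mulr1 exprVn.
    have dE : is_derive t (1 : R) (fun s : R => expR (- s^-1)) (expR (- t^-1) * t^-1 ^+ 2).
      have := is_deriveN dV; rewrite opprK => dN.
      exact: (is_derive1_comp (f := expR) (g := fun s : R => - s^-1)).
    have dX : is_derive t (1 : R) (fun s : R => s^-1 ^+ m) (- (m%:R * t^-1 ^+ m.+1)).
      have := is_deriveX m dV; rewrite exprfctE => dX; apply: is_derive_eq.
      case: (m) => [|m0 /=]; first by rewrite !mul0r oppr0 /GRing.scale/= ?mul0r.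
      by rewrite /GRing.scale/= mulrN -mulrA -exprD addn2.
    have dM := is_deriveM dX dE; refine (is_derive_eq dM _).
    rewrite /dflat /flat t0 /GRing.scale/= !exprS; ring.
- have L : h^-1 *: ((flat m \o shift (0 : R)) (h *: (1 : R)) - flat m 0) @[h --> 0^'] -->
      dflat m 0.
    have -> : dflat m 0 = 0 by rewrite /dflat /flat ltxx mulr0 subrr.
    apply/cvgrPdist_lt => e e0.
    (* The difference quotient at the origin with increment [h] is [flat m.+1 h]. *)
    have C0 : 0 < (m.+2)`!%:R :> R by rewrite ltr0n fact_gt0.
    exists (e / (m.+2)`!%:R); first by rewrite /= divr_gt0.
    move=> h /=; rewrite !sub0r !normrN => he h0.
    rewrite addr0 [h *: 1]mulr1 {2}/flat ltxx subr0 [_ *: _]flatS//.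
    apply: le_lt_trans (norm_flat_le _ _) _.
    by rewrite mulrC -ltr_pdivlMr.
  by apply: DeriveDef; [apply/cvg_ex; eexists; exact: L|exact/cvg_lim].
Unshelve. all: by end_near. Qed.

Lemma Ck_flat n k m (O : set 'rV[R]_n) q : open O -> Ck k O q -> Ck k O (flat m \o q).
Proof.
move=> oO; elim: k m => [|k IH] m Cq.
  split=> // x Ox; apply: continuous_comp; first exact: Ck_continuous Cq Ox.
  by apply/differentiable_continuous/derivable1_diffP; case: (is_derive_flat m (q x)).
apply: (Ck_comp1 oO Cq (psi := dflat m)) => [x _|]; first exact: is_derive_flat.
have C := CkD oO (IH m.+2 (CkS Cq)) (CkM oO (Ck_cst k O (- m%:R)) (IH m.+1 (CkS Cq))).
by apply: Ck_ext C => // x _; rewrite /= /dflat mulNr.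
Qed.

End FlatFunction.

Section Bump.
Context {R : realType} {n : nat}.
Implicit Types (x : 'rV[R]_n).

Lemma bump_exists (x0 : 'rV[R]_n) (r : R) : 0 < r ->
  exists (rho : 'rV[R]_n -> R) (K : set 'rV[R]_n),
  [/\ smooth_on setT rho, rho x0 != 0, compact K, K `<=` ball x0 r &
      forall x, ~ K x -> rho x = 0].
Proof.
move=> r0; have r20 : 0 < r / 2 by rewrite divr_gt0.
pose q x := (r / 2) ^+ 2 - \sum_j (x 0 j - x0 0 j) * (x 0 j - x0 0 j).
(* The function [q] is positive only inside the cube [K] of half-width [r / 2]. *)
pose K := [set x : 'rV[R]_n | forall j,
    (`[x0 0 j - r / 2, x0 0 j + r / 2]%classic : set R) (x ord0 j)].
exists (flat 0 \o q), K; split.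
- move=> k; apply: Ck_flat; first exact: openT.
  have C j : Ck k setT (fun x => x 0 j - x0 0 j).
    exact: CkD openT (Ck_coord _ _ openT) (Ck_cst _ _ (- x0 0 j)).
  apply: Ck_ext (CkD openT (Ck_cst k setT ((r / 2) ^+ 2)) (CkM openT (Ck_cst k setT (-1))
    (Ck_sum (index_enum 'I_n) openT (fun j => CkM openT (C j) (C j))))) => [|x _].
    exact: openT.
  by rewrite /= mulN1r.
- have -> : (flat 0 \o q) x0 = flat 0 ((r / 2) ^+ 2).
    rewrite /= /q big1 ?subr0// => j _; by rewrite subrr mul0r.
  by rewrite /flat exprn_gt0// expr0 mul1r gt_eqF// expR_gt0.
- exact: (@rV_compact R n (fun j => `[x0 0 j - r / 2, x0 0 j + r / 2]%classic)
    (fun j => @segment_compact R _ _)).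
- move=> x Kx; split=> // i j; rewrite (ord1 i) /ball/=.
  have := Kx j; rewrite /= in_itv/= => /andP[h1 h2].
  rewrite distrC ltr_distl; apply/andP; split; lra.
- move=> x nKx; rewrite /= /flat ifN//; apply: contra_notN nKx => qx j.
  rewrite /= in_itv/= -ler_distl -(@ler_pXn2r _ 2) ?nnegrE ?normr_ge0 ?(ltW r20)//.
  rewrite -normrX ger0_norm ?sqr_ge0//.
  apply: (@le_trans _ _ (\sum_j (x 0 j - x0 0 j) * (x 0 j - x0 0 j))).
    rewrite (bigD1 j)//= expr2 lerDl sumr_ge0// => i _; by rewrite -expr2 sqr_ge0.
  by move: qx; rewrite /q subr_gt0 => /ltW.
Qed.

Lemma smooth_bump_mul (O K : set 'rV[R]_n) (rho g : 'rV[R]_n -> R) :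
  open O -> smooth_on setT rho -> compact K -> K `<=` O ->
  (forall x, ~ K x -> rho x = 0) -> smooth_on O g ->
  smooth_on setT (fun x => rho x * g x).
Proof.
move=> oO srho cK KO rho0 sg k; apply: Ck_local => x _.
have [Ox|nOx] := pselect (O x).
  exists O => //; apply: CkM => //; exact: Ck_subset (srho k).
exists (~` K); first by move=> /KO.
have oK : open (~` K) by apply: closed_openC; apply: compact_closed => //; exact: norm_hausdorff.
apply: Ck_ext (Ck_cst k _ 0) => // y /rho0 /= ->; by rewrite mul0r.
Qed.

End Bump.

(** * Extension by zero of functions supported in a chart *)

Section ExtensionByZero.
Context {R : realType} {n : nat} (M : manifold R n).

Definition extension0 (c : chart R n M) (H : 'rV[R]_n -> R) (p : M) : R :=
  if `[< dom c p >] then H (loc c p) else 0.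

(** Near a point of the chart domain the extension is a smooth function composed with a change of
charts. Near any other point it vanishes, because the image of the compact support is closed: this is where
the Hausdorff property enters. *)
Lemma smooth_extension0 c H K : @atlas R n M c -> smooth_on setT H ->
  compact K -> K `<=` cod c -> (forall x, ~ K x -> H x = 0) ->
  extension0 c H \in @smooth_pred R n M.
Proof.
move=> Mc sH cK Kc H0; apply/asboolP => e Me k; apply: Ck_local => y [q eq <-].
have [cq|ncq] := pselect (dom c q).
- pose U := loc e @` (dom e `&` dom c).
  have oU : open U.
    have -> : U = cod e `&` par e @^-1` dom c.
      apply/seteqP; split=> [_ [p [ep cp] <-]|_ [[p ep <-]]].
        by split; [exists p|rewrite /= locK].
      by rewrite /= locK// => cp; exists p.
    rewrite openE => z [ez cz]; rewrite /interior.
    apply: filterI; first by apply: open_nbhs_nbhs; split => //; exact: open_cod.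
    apply: (par_continuous Me ez); apply: open_nbhs_nbhs; split => //; exact: open_dom.
  exists U; first by exists q.
  apply: (@Ck_ext _ _ _ _ (H \o (loc c \o par e))) => //.
    move=> _ [p [ep cp] <-]; rewrite /extension0 /= locK//.
    by case: asboolP.
  apply: (@Ck_comp _ _ _ _ U setT) => //; first exact: openT.
  by move=> j; exact: atlas_smooth.
- pose W := ~` (par c @` K).
  have oW : open W.
    apply: closed_openC; apply: compact_closed; first exact: hausdorffM.
    apply: continuous_compact => //; apply: continuous_in_subspaceT => x.
    by rewrite inE => /Kc; exact: par_continuous.
  have Wq : W q.
    by move=> [x /Kc[p cp <-]]; rewrite locK// => pq; apply: ncq; rewrite -pq.
  exists (cod e `&` par e @^-1` W).
    by split; [exists q|rewrite /= locK].
  apply: Ck_ext (Ck_cst k _ 0).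
    rewrite openE => z [ez cz]; rewrite /interior.
    apply: filterI; first by apply: open_nbhs_nbhs; split => //; exact: open_cod.
    by apply: (par_continuous Me ez); exact: open_nbhs_nbhs.
  move=> z [ez Wz]; rewrite /extension0 /=; case: asboolP => // cz.
  by rewrite H0// => Kz; apply: Wz; exists (loc c (par e z)) => //; rewrite locK.
Qed.

End ExtensionByZero.

(** * Vector fields as derivations: locality at a point *)

Section Evaluation.
Context {R : realType} {n : nat} (M : manifold R n).
Local Notation C := (Coo M).
Implicit Types (f g h : C) (X : vfield M) (p : M).

Lemma Coo_ext f g : (forall p, f p = g p) -> f = g.
Proof. by move=> fg; apply/val_inj/funext. Qed.

Lemma Coo_smooth f c : @atlas R n M c -> smooth_on (cod c) (f \o par c).
Proof. by case: f => f /= /asboolP sf; exact: sf. Qed.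

(** The value at a point, named so that it can carry the structure of a ring morphism. *)
Definition evalC p f : R := f p.

Lemma evalC_is_zmod_morphism p : zmod_morphism (evalC p).
Proof. by []. Qed.

Lemma evalC_is_monoid_morphism p : monoid_morphism (evalC p).
Proof. by []. Qed.

HB.instance Definition _ p :=
  GRing.isZmodMorphism.Build C R (evalC p) (evalC_is_zmod_morphism p).
HB.instance Definition _ p :=
  GRing.isMonoidMorphism.Build C R (evalC p) (evalC_is_monoid_morphism p).

Lemma vfieldD X f g : X (f + g) = X f + X g.
Proof. by have [] := vfieldP X. Qed.

Lemma vfieldM X f g : X (f * g) = f * X g + g * X f.
Proof. by have [] := vfieldP X. Qed.

Lemma vfieldN X f : X (- f) = - X f.
Proof. by apply: (addrI (X f)); rewrite -vfieldD !subrr vfield0. Qed.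

Lemma vfieldB X f g : X (f - g) = X f - X g.
Proof. by rewrite vfieldD vfieldN. Qed.

Lemma vfield1 X : X 1 = 0.
Proof.
by have /eqP := vfieldM X 1 1; rewrite !mul1r -subr_eq0 opprD addrA subrr sub0r
  oppr_eq0 => /eqP.
Qed.

Lemma vfieldZ X a f : X (constC M a * f) = constC M a * X f.
Proof. by have [] := vfieldP X. Qed.

Lemma vfield_cst X a : X (constC M a) = 0.
Proof. by rewrite -[constC M a]mulr1 vfieldZ vfield1 mulr0. Qed.

Lemma vfield_sum X (I : Type) (s : seq I) (F : I -> C) :
  X (\sum_(i <- s) F i) = \sum_(i <- s) X (F i).
Proof.
by elim: s => [|i s IH]; rewrite ?big_nil ?vfield0// !big_cons vfieldD IH.
Qed.

Lemma vfieldXn X f k : f * X (f ^+ k) = k%:R * f ^+ k * X f.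
Proof.
elim: k => [|k IH]; first by rewrite expr0 vfield1 mulr0 !mul0r.
rewrite exprS vfieldM mulrDr mulrCA [f * X (f ^+ k)]IH -natr1; ring.
Qed.

(** A derivation only sees the differential of a function at a point. In a chart,
the Hadamard lemma writes [f - f p] as a sum of products of two functions vanishing at [p]; multiplied by bump
functions, these become global functions, and the Leibniz rule gives [0]. *)
Lemma vfield_vanishes X f p c : @atlas R n M c -> dom c p ->
  (forall i, 'D_(delta_mx 0 i) (f \o par c) (loc c p) = 0) -> X f p = 0.
Proof.
move=> Mc cp Df0; pose F := f \o par c; pose x0 := loc c p.
have sF : smooth_on (cod c) F by exact: Coo_smooth.
have codx0 : cod c x0 by exists p.
have /nbhs_ballP[r /= r0 rcod] : nbhs x0 (cod c).
  by apply: open_nbhs_nbhs; split => //; exact: open_cod.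
have oB : open (ball x0 r) by exact: ball_open.
have [rho0 [K [srho rhox0 cK KB rhoK]]] := bump_exists x0 r0.
have ext (u : 'rV[R]_n -> R) : smooth_on (ball x0 r) u ->
    extension0 c (fun x => rho0 x * u x) \in @smooth_pred R n M.
  move=> sg; apply: (smooth_extension0 Mc _ cK) => [|x /KB /rcod//|x /rhoK ->].
    exact: smooth_bump_mul oB srho cK KB rhoK sg.
  by rewrite mul0r.
have s1 : smooth_on (ball x0 r) (cst (1 : R)) by move=> k; exact: Ck_cst.
have sX i : smooth_on (ball x0 r) (fun x => x 0 i - x0 0 i).
  by move=> k; exact: CkD oB (Ck_coord _ _ oB) (Ck_cst _ _ (- x0 0 i)).
have sG i : smooth_on (ball x0 r) (radial_mean x0 0 ('D_(delta_mx 0 i) F)).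
  move=> k; apply: Ck_radial_mean; apply: Ck_subset rcod _.
  exact: smooth_on_partial.
pose rho : C := SmoothFun (ext _ s1).
pose Xi i : C := SmoothFun (ext _ (sX i)).
pose G i : C := SmoothFun (ext _ (sG i)).
have E : rho * rho * (f - constC M (f p)) = \sum_i Xi i * G i.
  apply: Coo_ext => q; rewrite -[LHS]/(evalC q _) -[RHS]/(evalC q _) rmorph_sum !rmorphM rmorphB.
  under eq_bigr do rewrite rmorphM.
  rewrite /= /evalC /= /extension0; case: asboolP => cq; last first.
    by rewrite mul0r mul0r big1// => i _; rewrite mul0r.
  have [Kq|nKq] := pselect (K (loc c q)); last first.
    by rewrite rhoK// !mul0r big1// => i _; rewrite !mul0r.
  (* In the support of the bump function the Hadamard lemma applies. *)
  have Hd : F (loc c q) - F x0 = f q - f p by rewrite /F /= !locK.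
  rewrite -Hd (@hadamard _ _ x0 r)//; last first.
  - exact: KB.
  - by apply: Ck_subset rcod _; exact: sF.
  by rewrite mulr1 mulr_sumr; apply: eq_bigr => i _; ring.
have := congr1 (fun g => X g p) E; rewrite vfield_sum vfieldM vfieldB vfield_cst subr0.
rewrite -[RHS]/(evalC p _) rmorph_sum big1 => [|i _]; last first.
  rewrite vfieldM rmorphD !rmorphM /= /evalC /= /extension0 asboolT//.
  by rewrite radial_mean_center subrr Df0 !mulr0 !mul0r addr0.
rewrite -[LHS]/(evalC p _) rmorphD !rmorphM rmorphB /= /evalC /= subrr mul0r addr0.
rewrite /extension0 asboolT// mulr1 => /eqP.
by rewrite mulf_eq0 mulf_eq0 (negPf rhox0) => /eqP.
Qed.

End Evaluation.

(** * Quotients and logarithms of smooth functions *)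

Section Gluing.
Context {R : realType} {n : nat} (M : manifold R n).
Local Notation C := (Coo M).

(** A function which is locally a quotient of smooth functions with nonvanishing
denominator is smooth; the cross relations say that the local quotients agree. *)
Lemma glue_quotients (I : Type) (a b : I -> C) :
  (forall i j, a i * b j = a j * b i) -> (forall p, exists i, b i p != 0) ->
  exists g : C, forall i, a i = g * b i.
Proof.
move=> ab /choice[s bs]; pose g p := a (s p) p / b (s p) p.
have abp i j p : a i p * b j p = a j p * b i p.
  exact: (congr1 (fun f : C => f p) (ab i j)).
have gE i p : b i p != 0 -> g p = a i p / b i p.
  by move=> bi; apply/eqP; rewrite /g eqr_div//; apply/eqP; exact: abp.
have sg : g \in @smooth_pred R n M.
  apply/asboolP => c Mc k; apply: Ck_local => x cx; pose i := s (par c x).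
  pose U := cod c `&` [set y | (b i \o par c) y != 0].
  have oU : open U.
    rewrite openE => y [cy by0]; rewrite /interior.
    apply: filterI; first by apply: open_nbhs_nbhs; split => //; exact: open_cod.
    have cb : {for y, continuous (b i \o par c)}.
      exact: (Ck_continuous (Coo_smooth (b i) Mc 0) cy).
    apply: (cb [set z : R | z != 0]); apply: open_nbhs_nbhs.
    by split; [exact: (@open_neq R 0)|exact: by0].
  exists U; first by split => //; exact: bs.
  have Uc : U `<=` cod c by move=> y [].
  have Ca := Ck_subset Uc (Coo_smooth (a i) Mc k).
  have Cb := Ck_subset Uc (Coo_smooth (b i) Mc k).
  apply: (Ck_ext oU _ (CkM oU Ca (CkV oU _ Cb))) => y [_ by0] //.
  by rewrite /= (gE i).
exists (SmoothFun sg) => i; apply: Coo_ext => p.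
rewrite -[RHS]/(g p * b i p) /g mulrAC.
by apply: (mulIf (bs p)); rewrite divfK ?bs // abp.
Qed.

(** The witness is [ln (h ^ 2) / 2], the logarithm of the absolute value of [h]. A derivation
is an abstract operator, so the chain rule for the logarithm is not available for it; it is recovered at each
point [p] by applying [vfield_vanishes] to [h p * l - h]. *)
Lemma exists_log (h : C) : (forall p, h p != 0) ->
  exists l : C, forall X : vfield M, h * X l = X h.
Proof.
move=> h0; pose L p := 2^-1 * ln (h p * h p).
have hh p : 0 < h p * h p by rewrite -expr2 exprn_even_gt0// h0.
have dln (x : R) : 0 < x -> is_derive x (1 : R) (@ln R) x^-1 by exact: is_derive1_ln.
have sL : L \in @smooth_pred R n M.
  apply/asboolP => c Mc k; have oc := open_cod Mc.
  have Ch j := CkM oc (Coo_smooth h Mc j) (Coo_smooth h Mc j).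
  apply: (CkM oc (Ck_cst _ _ (2^-1 : R))); case: k => [|k].
    split=> // x cx; apply: continuous_comp; first exact: Ck_continuous (Ch 0%N) cx.
    by apply: continuous_ln; exact: hh.
  apply: (Ck_comp1 oc (Ch k.+1) (psi := fun y => y^-1)) => [x cx|].
    by apply: dln; exact: hh.
  by apply: CkV => // x cx; rewrite gt_eqF ?hh.
exists (SmoothFun sL) => X; apply: Coo_ext => p.
have [c Mc cp] := atlas_cover p.
have := @vfield_vanishes _ _ _ X (constC M (h p) * SmoothFun sL - h) p c Mc cp.
rewrite vfieldB vfieldZ => H; apply/eqP; rewrite -subr_eq0; apply/eqP; apply: H => i.
have codx : cod c (loc c p) by exists p.
pose H := h \o par c.
have dH : is_derive (loc c p) (delta_mx 0 i) H ('D_(delta_mx 0 i) H (loc c p)).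
  by apply: derivableP; exact: smooth_on_derivable (Coo_smooth h Mc) codx.
have Hp : H (loc c p) = h p by rewrite /H /= locK.
have hh0 : 0 < (H * H) (loc c p) by rewrite fctE Hp; exact: hh.
(* The differential of [h p * ln (h ^ 2) / 2 - h] vanishes at [p]. *)
have dHH := is_derive_comp1 (is_deriveM dH dH) (dln _ hh0).
have dlog := is_deriveB (is_deriveZ (h p / 2) dHH) dH.
have -> : (constC M (h p) * SmoothFun sL - h) \o par c = (h p / 2) *: (@ln R \o (H * H)) - H.
  by apply/funext => y; rewrite /= [LHS]/= /L mulrA.
case: dlog => _ ->; rewrite fctE Hp /GRing.scale/=.
have := h0 p; move: (derive _ _ _) (h p) => d u u0; field.
by rewrite u0.
Qed.

End Gluing.

(** * Alternating forms over a commutative ring *)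

Section AlternatingForms.
Context {K : comPzRingType} {L : lmodType K} {r : nat}.
Implicit Types (v : 'I_r -> L) (w : ('I_r -> L) -> K) (x y : L).

Lemma update_same v i x : update v i x i = x.
Proof. by rewrite /update eqxx. Qed.

Lemma update_other v i j x : j != i -> update v i x j = v j.
Proof. by rewrite /update => /negPf->. Qed.

Lemma update_id v i : update v i (v i) = v.
Proof. by apply/funext => j; rewrite /update; case: eqP => [->|]. Qed.

Lemma update_update v i x y : update (update v i x) i y = update v i y.
Proof. by apply/funext => j; rewrite /update; case: eqP. Qed.

Lemma updateC v i j x y : i != j ->
  update (update v i x) j y = update (update v j y) i x.
Proof.
move=> ij; apply/funext => k; rewrite /update; have [->|] := eqVneq k i => //.
by rewrite (negPf ij).
Qed.

Section Alternating.
Variables (w : ('I_r -> L) -> K) (alt_w : alternating_form w).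

Lemma alternating_linear v i a x y :
  w (update v i (a *: x + y)) = a * w (update v i x) + w (update v i y).
Proof. exact: alt_w.1. Qed.

Lemma alternating_eq0 v i j : i != j -> v i = v j -> w v = 0.
Proof. exact: alt_w.2. Qed.

Lemma alternatingD v i x y :
  w (update v i (x + y)) = w (update v i x) + w (update v i y).
Proof. by rewrite -{1}[x]scale1r alternating_linear mul1r. Qed.

Lemma alternating0 v i : w (update v i 0) = 0.
Proof. by apply: (addrI (w (update v i 0))); rewrite -alternatingD !addr0. Qed.

Lemma alternatingZ v i a x : w (update v i (a *: x)) = a * w (update v i x).
Proof. by rewrite -[a *: x]addr0 alternating_linear alternating0 addr0. Qed.

Lemma alternating_sum v i (I : Type) (s : seq I) (F : I -> L) :
  w (update v i (\sum_(k <- s) F k)) = \sum_(k <- s) w (update v i (F k)).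
Proof.
elim: s => [|k s IH]; first by rewrite !big_nil alternating0.
by rewrite !big_cons alternatingD IH.
Qed.

Lemma alternating_swap v i j x y : i != j ->
  w (update (update v i x) j y) = - w (update (update v i y) j x).
Proof.
move=> ij; apply/eqP; rewrite -addr_eq0; apply/eqP.
have Z u : w (update (update v i u) j u) = 0.
  by apply: (@alternating_eq0 _ i j) => //; rewrite update_same update_other ?update_same// eq_sym.
have := Z (x + y); rewrite alternatingD !(updateC _ _ _ ij) !alternatingD.
by rewrite -!(updateC _ _ _ ij) !Z add0r addr0 => H; rewrite addrC.
Qed.

Lemma alternating_tperm v i j : i != j -> w (v \o tperm i j) = - w v.
Proof.
move=> ij; have -> : v \o tperm i j = update (update v i (v j)) j (v i).
  apply/funext => k; rewrite /= /update; case: tpermP => [->|->|/eqP ki /eqP kj].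
  - by rewrite (negPf ij) eqxx.
  - by rewrite eqxx.
  - by rewrite (negPf ki) (negPf kj).
by rewrite alternating_swap// update_id update_id.
Qed.

(** An alternating form is controlled by its value on a generating family: expanding
[c * v_i] slot by slot leaves values on families of generators, which are zero or plus or minus [w b]. The
predicate [Z] stands for membership in an ideal of [K]; vanishing and vanishing at a point are the two cases of
interest. *)
Lemma alternating_span (Z : K -> Prop) (b : 'I_r -> L) (c : K) :
  (forall a a', Z a -> Z a' -> Z (a + a')) -> (forall a a', Z a' -> Z (a * a')) ->
  (forall x, exists beta : 'I_r -> K, c *: x = \sum_j beta j *: b j) ->
  Z (w b) -> forall v, Z (c ^+ r * w v).
Proof.
move=> ZD ZM span Zb.
have Z0 : Z 0 by rewrite -(mul0r (w b)); exact: ZM.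
have ZN a : Z a -> Z (- a) by rewrite -mulN1r; exact: ZM.
(* Permutations are products of transpositions. *)
have Zperm (s : 'S_r) : Z (w (b \o s)).
  have [ts -> _] := prod_tpermP s.
  elim: ts b Zb {span} => [|t ts IH] b' Zb'.
    rewrite big_nil (_ : b' \o _ = b')//; apply/funext => i.
    by rewrite /= perm1.
  rewrite big_cons; have -> : b' \o (tperm t.1 t.2 * \prod_(t0 <- ts) tperm t0.1 t0.2)%g
    = (b' \o (\prod_(t0 <- ts) tperm t0.1 t0.2)%g) \o tperm t.1 t.2.
    by apply/funext => i; rewrite /= permM.
  have [->|ij] := eqVneq t.1 t.2.
    rewrite tperm1 (_ : _ \o _ = b' \o (\prod_(t0 <- ts) tperm t0.1 t0.2)%g); first exact: IH.
    by apply/funext => i; rewrite /= perm1.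
  by rewrite alternating_tperm//; apply/ZN/IH.
have Zfun (f : 'I_r -> 'I_r) : Z (w (b \o f)).
  have [/injectiveP injf|/injectivePn[i [j ij fij]]] := boolP (injectiveb f).
    rewrite (_ : b \o f = b \o perm injf)//.
    by apply/funext => i; rewrite /= permE.
  by rewrite (@alternating_eq0 _ i j)//= fij.
suff H (k : nat) v : (k <= r)%N -> (forall i : 'I_r, (k <= i)%N -> exists j, v i = b j) ->
    Z (c ^+ k * w v).
  by move=> v; apply: H => // i; rewrite leqNgt ltn_ord.
elim: k v => [|k IH] v kr Hv.
  have /choice[f fE] : forall i, exists j, v i = b j by move=> i; exact: Hv.
  by rewrite expr0 mul1r (_ : v = b \o f)//; apply/funext.
pose i := Ordinal kr; have [beta Hb] := span (v i).
rewrite exprSr -mulrA -{1}(update_id v i) -alternatingZ Hb alternating_sum mulr_sumr.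
elim: (index_enum _) => [|j s IHs]; first by rewrite big_nil.
rewrite big_cons; apply: ZD => //; rewrite alternatingZ mulrCA; apply: ZM.
apply: IH => [|i']; first exact: ltnW.
rewrite leq_eqVlt /update => /orP[/eqP ki|ki]; first by rewrite ifT; [exists j|apply/eqP/val_inj].
by case: eqP => [_|_]; [exists j|exact: Hv].
Qed.

Section Derivation.
Variables (D : K -> K) (T : L -> L).
Hypotheses (DD : forall a b, D (a + b) = D a + D b).
Hypothesis (DM : forall a b, D (a * b) = a * D b + b * D a).
Hypotheses (TD : forall x y, T (x + y) = T x + T y).
Hypothesis (TZ : forall a x, T (a *: x) = a *: T x + D a *: x).

Lemma form_derivation_update v i x :
  form_derivation D T w (update v i x) =
  D (w (update v i x)) - w (update v i (T x)) -
  \sum_(k < r | k != i) w (update (update v k (T (v k))) i x).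
Proof.
rewrite /form_derivation (bigD1 i)//= update_same update_update opprD addrA.
congr (_ - _); apply: eq_bigr => k ki.
by rewrite update_other// updateC// eq_sym.
Qed.

Lemma alternating_form_derivation : alternating_form (form_derivation D T w).
Proof.
split=> [v i a x y|v i j ij vij].
  rewrite !form_derivation_update alternating_linear DD DM TD TZ !alternatingD !alternatingZ.
  under eq_bigr do rewrite alternating_linear.
  rewrite big_split/= -mulr_sumr; ring.
rewrite /form_derivation (alternating_eq0 ij vij).
have -> : D 0 = 0 by apply: (addrI (D 0)); rewrite -DD !addr0.
rewrite sub0r (bigD1 i)//= (bigD1 j) 1?eq_sym//= big1 => [|k /andP[ki kj]]; last first.
  by apply: (alternating_eq0 ij); rewrite !update_other// eq_sym.
rewrite addr0; apply/eqP; rewrite oppr_eq0 addr_eq0; apply/eqP.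
have E1 : update v i (T (v i)) = update (update v i (T (v i))) j (v i).
  apply/funext => k; rewrite /update; have [->|//] := eqVneq k j.
  by rewrite eq_sym (negPf ij).
have E2 : update v j (T (v j)) = update (update v i (v i)) j (T (v i)).
  by rewrite update_id vij.
by rewrite E1 E2 alternating_swap.
Qed.

End Derivation.
End Alternating.

(** In both compositions the terms where the two derivations act on different slots agree,
and the mixed terms cancel. *)
Lemma form_derivation_comm (D1 D2 : K -> K) (T1 T2 : L -> L) w v :
  (forall a b, D1 (a - b) = D1 a - D1 b) -> (forall a b, D2 (a - b) = D2 a - D2 b) ->
  (forall v i x y, w (update v i (x - y)) = w (update v i x) - w (update v i y)) ->
  form_derivation D1 T1 (form_derivation D2 T2 w) v -
  form_derivation D2 T2 (form_derivation D1 T1 w) v =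
  form_derivation (fun a => D1 (D2 a) - D2 (D1 a)) (fun x => T1 (T2 x) - T2 (T1 x)) w v.
Proof.
move=> D1B D2B wB.
have sumE (D : K -> K) (F : 'I_r -> K) : (forall a b, D (a - b) = D a - D b) ->
    D (\sum_i F i) = \sum_i D (F i).
  move=> DB; have D0 : D 0 = 0 by have := DB 0 0; rewrite !subrr.
  have DD a b : D (a + b) = D a + D b.
    have DN : D (- b) = - D b by rewrite -sub0r DB D0 sub0r.
    by have := DB a (- b); rewrite DN !opprK.
  exact: (big_morph D DD D0).
have E (D D' : K -> K) (T T' : L -> L) : (forall a b, D (a - b) = D a - D b) ->
    form_derivation D T (form_derivation D' T' w) v =
    D (D' (w v)) - \sum_i D (w (update v i (T' (v i))))
    - (\sum_i D' (w (update v i (T (v i)))) - \sum_i w (update v i (T' (T (v i))))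
       - \sum_i \sum_(k < r | k != i) w (update (update v k (T' (v k))) i (T (v i)))).
  move=> DB; transitivity (D (D' (w v) - \sum_i w (update v i (T' (v i)))) -
    \sum_i form_derivation D' T' w (update v i (T (v i)))); first by [].
  rewrite DB (sumE _ _ DB); congr (_ - _).
  under eq_bigr do rewrite form_derivation_update.
  by rewrite !sumrB.
rewrite (E _ _ _ _ D1B) (E _ _ _ _ D2B) [RHS]/form_derivation.
under [X in _ = _ - X]eq_bigr do rewrite wB.
rewrite sumrB.
have -> : \sum_i \sum_(k < r | k != i) w (update (update v k (T2 (v k))) i (T1 (v i))) =
    \sum_i \sum_(k < r | k != i) w (update (update v k (T1 (v k))) i (T2 (v i))).
  rewrite (exchange_big_dep xpredT)//=; apply: eq_bigr => i _.
  rewrite (eq_bigl (fun k => k != i)) => [|k]; last by rewrite eq_sym.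
  by apply: eq_bigr => k ki; rewrite updateC// eq_sym.
ring.
Qed.

Lemma alternating_formD w w' : alternating_form w -> alternating_form w' ->
  alternating_form (fun v => w v + w' v).
Proof.
move=> [wl w0] [wl' w0']; split=> [v i a x y|v i j ij vij].
  by rewrite wl wl' mulrDr addrACA.
by rewrite (w0 _ _ _ ij)// (w0' _ _ _ ij)// addr0.
Qed.

Lemma alternating_formZ a w : alternating_form w ->
  alternating_form (fun v => a * w v).
Proof.
move=> [wl w0]; split=> [v i b x y|v i j ij vij].
  by rewrite wl mulrDr mulrCA.
by rewrite (w0 _ _ _ ij)// mulr0.
Qed.

End AlternatingForms.

(** * Frames *)

Section Frames.
Context {K : comPzRingType} {r : nat}.

Lemma dual_ext (L : lmodType K) (xi zeta : dual L) : (forall x, xi x = zeta x) -> xi = zeta.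
Proof. by move=> E; apply/val_inj/funext. Qed.

Lemma dual_sumr (L : lmodType K) (xi : dual L) (I : Type) (s : seq I) (F : I -> L) :
  xi (\sum_(i <- s) F i) = \sum_(i <- s) xi (F i).
Proof.
elim: s => [|i s IH]; last by rewrite !big_cons dualDr IH.
by rewrite !big_nil -(scale0r (0 : L)) dualZr mul0r.
Qed.

Lemma dual_suml (L : lmodType K) (I : Type) (s : seq I) (F : I -> dual L) (x : L) :
  (\sum_(i <- s) F i) x = \sum_(i <- s) F i x.
Proof. by elim: s => [|i s IH]; rewrite ?big_nil// !big_cons dualDl IH. Qed.

Lemma dual_eval_subproof (L : lmodType K) (x : L) :
  (fun xi : dual L => xi x) \in @linear_pred _ (dual L).
Proof. by apply/asboolP. Qed.

Definition dual_eval (L : lmodType K) (x : L) : dual (dual L) := Dual (dual_eval_subproof x).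

(** A basis up to the factor [m], with dual family [bs]. Asking for an honest basis would restrict
to open subsets; with the factor, every family of vector fields gives a frame of globally defined fields, and it is a
genuine basis where [m] does not vanish. *)
Definition frame (L : lmodType K) (b : 'I_r -> L) (bs : 'I_r -> dual L) (m : K) :=
  (forall x, m *: x = \sum_j bs j x *: b j) /\
  (forall i j, bs i (b j) = m * (i == j)%:R).

Lemma dual_frame (L : lmodType K) (b : 'I_r -> L) bs m :
  frame b bs m -> frame bs (fun i => dual_eval (b i)) m.
Proof.
move=> [span dualb]; split=> [xi|i j]; last by rewrite eq_sym -dualb.
apply: dual_ext => x; rewrite dualZl -dualZr span dual_sumr dual_suml.
by apply: eq_bigr => j _; rewrite dualZr mulrC.
Qed.

(** The trace formula for the action of a derivation on a top form. *)
Lemma form_derivation_frame (L : lmodType K) (b : 'I_r -> L) bs m D T w :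
  frame b bs m -> alternating_form w ->
  m * form_derivation D T w b = m * D (w b) - (\sum_i bs i (T (b i))) * w b.
Proof.
move=> [span _] aw; rewrite /form_derivation mulrBr; congr (_ - _).
rewrite mulr_sumr mulr_suml; apply: eq_bigr => i _.
rewrite -(alternatingZ aw) span (alternating_sum aw) (bigD1 i)//= big1 => [|j ji].
  by rewrite addr0 (alternatingZ aw) update_id.
rewrite (alternatingZ aw) (@alternating_eq0 _ _ _ _ aw _ i j) ?mulr0 1?eq_sym//.
by rewrite update_same update_other.
Qed.

Lemma alternating_det_l (L : lmodType K) (x : 'I_r -> L) :
  alternating_form (fun u : 'I_r -> dual L => \det (\matrix_(i, j) u i (x j))).
Proof.
split=> [u i a xi zeta|u i j ij uij].
  have -> := @determinant_multilinear _ _ (\matrix_(k, j) update u i (a *: xi + zeta) k (x j))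
    (\matrix_(k, j) update u i xi k (x j)) (\matrix_(k, j) update u i zeta k (x j)) i a 1.
  - by rewrite mul1r.
  - by apply/rowP => j; rewrite !mxE !update_same mul1r dualDl dualZl.
  - by apply/matrixP => k j; rewrite !mxE !update_other// eq_sym neq_lift.
  - by apply/matrixP => k j; rewrite !mxE !update_other// eq_sym neq_lift.
by apply: (determinant_alternate ij) => k; rewrite !mxE uij.
Qed.

Lemma alternating_det_r (L : lmodType K) (u : 'I_r -> dual L) :
  alternating_form (fun x : 'I_r -> L => \det (\matrix_(i, j) u i (x j))).
Proof.
have E (x : 'I_r -> L) : \det (\matrix_(i, j) u i (x j)) =
    \det (\matrix_(j, i) dual_eval (x j) (u i)).
  by rewrite -det_tr; congr (\det _); apply/matrixP => i j; rewrite !mxE.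
split=> [x i a y z|x i j ij xij]; rewrite !E; last first.
  by apply: (determinant_alternate ij) => k; rewrite !mxE xij.
have U t : (fun j => dual_eval (update x i t j)) = update (fun j => dual_eval (x j)) i (dual_eval t).
  by apply/funext => j; rewrite /update; case: eqP.
have := (alternating_det_l (u : 'I_r -> dual L)).1 (fun j => dual_eval (x j)) i a (dual_eval y) (dual_eval z).
have <- : dual_eval (a *: y + z) = a *: dual_eval y + dual_eval z.
  by apply: dual_ext => xi; rewrite dualDl dualZl /= -dual_is_linear.
by rewrite -!U.
Qed.

End Frames.

(** * Proportionality of top forms *)

Section TopForms.
Context {R : realType} {n : nat} (M : manifold R n) {r : nat}.
Local Notation C := (Coo M).

Definition has_frames (L : lmodType C) := forall p : M, exists b bs m,
  @frame C r L b bs m /\ m p != 0.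

Lemma dual_has_frames (L : lmodType C) : has_frames L -> has_frames (dual L).
Proof.
move=> HL p; have [b [bs [m [Hb mp]]]] := HL p.
by exists bs, (fun i => dual_eval (b i)), m; split => //; exact: dual_frame.
Qed.

(** Lemma [alternating_span] for the ideal of functions vanishing at [p]. *)
Lemma alternating_vanish (L : lmodType C) (w : ('I_r -> L) -> C)
    (b : 'I_r -> L) (bs : 'I_r -> dual L) (m : C) (p : M) :
  alternating_form w -> frame b bs m -> m p != 0 -> w b p = 0 -> forall v, w v p = 0.
Proof.
move=> aw [span _] mp wb v.
have Zs := @alternating_span _ _ _ w aw (fun f : C => evalC p f = 0) b m.
have /eqP : evalC p (m ^+ r * w v) = 0.
  apply: Zs => //.
  - by move=> f g f0 g0; rewrite -[LHS]/(evalC p f + evalC p g) f0 g0 addr0.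
  - by move=> f g g0; rewrite -[LHS]/(evalC p f * evalC p g) g0 mulr0.
  - by move=> x; exists (bs ^~ x).
by rewrite rmorphM rmorphXn mulf_eq0 expf_eq0 (negPf mp) andbF => /eqP.
Qed.

(** The difference of both sides is alternating in [v] and in [v'], and it vanishes when both
are equal to the same frame. *)
Lemma top_forms_proportional (L : lmodType C) (w w' : ('I_r -> L) -> C) :
  has_frames L -> alternating_form w -> alternating_form w' ->
  forall v v', w v * w' v' = w v' * w' v.
Proof.
move=> HL aw aw' v v'; apply: Coo_ext => p; have [b [bs [m [Hb mp]]]] := HL p.
apply/eqP; rewrite -subr_eq0; apply/eqP; rewrite -[_ - _]/((w v * w' v' - w v' * w' v) p).
pose D v1 v2 := w v1 * w' v2 - w v2 * w' v1; rewrite -/(D v v').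
have aD v2 : alternating_form (D ^~ v2).
  have := alternating_formD (alternating_formZ (w' v2) aw) (alternating_formZ (- w v2) aw').
  congr (alternating_form _); apply/funext => v1.
  by rewrite /D mulNr mulrC.
apply: (alternating_vanish (aD v') Hb mp).
have -> : D b v' = - D v' b by rewrite /D opprB.
rewrite -[LHS]/(- (D v' b p)) (alternating_vanish (aD b) Hb mp) ?oppr0//.
by rewrite /D subrr.
Qed.

Lemma top_form_quotient (L : lmodType C) (w w' : ('I_r -> L) -> C) :
  has_frames L -> nonvanishing_form w -> alternating_form w' ->
  exists g, forall v, w' v = g * w v.
Proof.
move=> HL [aw w0] aw'; apply: glue_quotients => // v v'.
by rewrite mulrC (top_forms_proportional HL aw aw') mulrC.
Qed.

(** The function [h] is the duality pairing of the two top forms: both sides are top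
forms in [u] and in [x] separately. *)
Lemma top_forms_pairing (L : lmodType C) (eta : ('I_r -> dual L) -> C)
    (nu : ('I_r -> L) -> C) :
  has_frames L -> nonvanishing_form eta -> nonvanishing_form nu ->
  exists2 h : C, (forall p, h p != 0) &
    forall u x, eta u * nu x = h * \det (\matrix_(i, j) u i (x j)).
Proof.
move=> HL [aeta eta0] [anu nu0].
pose a (z : ('I_r -> dual L) * ('I_r -> L)) := eta z.1 * nu z.2.
pose d (z : ('I_r -> dual L) * ('I_r -> L)) := \det (\matrix_(i, j) z.1 i (z.2 j)).
have [||h hE] := @glue_quotients _ _ M _ a d.
- move=> [u x] [u' x']; rewrite /a /d /=.
  have := top_forms_proportional (dual_has_frames HL) aeta (alternating_det_l x') u u'.
  have /= := top_forms_proportional HL anu (alternating_det_r u) x x'.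
  move: (\det _) (\det _) (\det _) => d1 d2 d3 E1 E2.
  by rewrite -mulrA (mulrC (nu x)) mulrA E2 -mulrA (mulrC d3) E1 mulrA.
- move=> p; have [b [bs [m [[span dualb] mp]]]] := HL p.
  exists (bs, b); rewrite /d /=.
  have -> : \matrix_(i, j) bs i (b j) = m%:M.
    by apply/matrixP => i j; rewrite !mxE dualb mulr_natr.
  rewrite det_scalar -/(evalC p _) rmorphXn expf_neq0//.
exists h => [p|u x]; last exact: (hE (u, x)).
have [u up] := eta0 p; have [x xp] := nu0 p.
have := congr1 (evalC p) (hE (u, x)); rewrite /a rmorphM [RHS]rmorphM /= => E.
by apply: contraNneq (mulf_neq0 up xp) => hp; rewrite -[X in X * _]/(evalC p _) -[X in _ * X]/(evalC p _) E /evalC hp mul0r.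
Qed.

End TopForms.

(** * Linear relations between vector fields *)

Section Rank.
Context {R : realType} {n : nat} (M : manifold R n).
Local Notation C := (Coo M).
Implicit Types (f g h : C) (X Y : vfield M) (p : M).

Lemma vfield_ext X Y : (forall f, X f = Y f) -> X = Y.
Proof. by move=> E; apply/val_inj/funext. Qed.

Lemma vfieldNl X f : (- X) f = - X f. Proof. by []. Qed.

Lemma vfieldBl X Y f : (X - Y) f = X f - Y f.
Proof. by []. Qed.

Lemma lie_vfE X Y f : lie_vf X Y f = X (Y f) - Y (X f).
Proof. by []. Qed.

Lemma vfield_suml (I : Type) (s : seq I) (F : I -> vfield M) f :
  (\sum_(i <- s) F i) f = \sum_(i <- s) F i f.
Proof. by elim: s => [|i s IH]; rewrite ?big_nil// !big_cons vfieldDl IH. Qed.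

Lemma evalC_sum p (I : Type) (s : seq I) (F : I -> C) :
  (\sum_(i <- s) F i) p = \sum_(i <- s) F i p.
Proof. exact: (rmorph_sum (evalC p)). Qed.

Lemma evalCM p f g : (f * g) p = f p * g p. Proof. by []. Qed.
Lemma evalCB p f g : (f - g) p = f p - g p. Proof. by []. Qed.
Lemma evalC0 p : (0 : C) p = 0. Proof. by []. Qed.
Lemma Coo_neq0 f : f <> 0 -> exists p, f p != 0.
Proof.
move=> f0; apply/not_existsP => H; apply: f0; apply: Coo_ext => p.
by apply/eqP/negPn/negP => fp; exact: (H p).
Qed.

Lemma derive_combination p c (s : 'I_n.+1 -> R) (F : 'I_n.+1 -> C) i :
  @atlas R n M c -> dom c p ->
  'D_(delta_mx 0 i) ((\sum_k constC M (s k) * F k) \o par c) (loc c p) =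
  \sum_k s k * 'D_(delta_mx 0 i) (F k \o par c) (loc c p).
Proof.
move=> Mc cp; have codx : cod c (loc c p) by exists p.
have D k : is_derive (loc c p) (delta_mx 0 i) (s k *: (F k \o par c))
    (s k *: 'D_(delta_mx 0 i) (F k \o par c) (loc c p)).
  apply: is_deriveZ; apply: derivableP.
  exact: smooth_on_derivable (Coo_smooth (F k) Mc) codx.
have [_ <-] := is_derive_sum D.
by congr ('D__ _ _); apply/funext => y; rewrite /= evalC_sum fct_sumE.
Qed.

(** The [n + 1] differentials at [p] of the [f_j] and of [g] are linearly dependent, and by
[vfield_vanishes] every vector field inherits the dependence. The determinant condition ensures that [g] occurs in it
with nonzero coefficient. *)
Lemma vfield_combination p (v : 'I_n -> vfield M) (f : 'I_n -> C) g :
  (\det (\matrix_(i, j) v i (f j))) p != 0 ->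
  exists t : 'I_n -> R, forall X, X g p = \sum_j t j * X (f j) p.
Proof.
move=> det0; have [c Mc cp] := atlas_cover p.
(* The first row belongs to [g], the others to the [f_j]. *)
pose F k := if unlift ord0 k is Some j then f j else g.
pose D := \matrix_(k < n.+1, i < n) 'D_(delta_mx 0 i) (F k \o par c) (loc c p).
have [s s0 sD] : exists2 s : 'rV[R]_n.+1, s != 0 & s *m D = 0.
  have : kermx D != 0.
    rewrite -mxrank_eq0 mxrank_ker subn_eq0 -ltnNge ltnS.
    exact: rank_leq_col.
  by move=> /rowV0Pn[s /sub_kermxP sD s0]; exists s.
have sX X : s 0 ord0 * X g p + \sum_j s 0 (lift ord0 j) * X (f j) p = 0.
  have := @vfield_vanishes _ _ _ X (\sum_k constC M (s 0 k) * F k) p c Mc cp.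
  move=> H; rewrite -[RHS]H; last first.
    move=> i; rewrite derive_combination//.
    transitivity ((s *m D) 0 i); last by rewrite sD mxE.
    by rewrite mxE; apply: eq_bigr => k _; rewrite mxE.
  rewrite vfield_sum evalC_sum big_ord_recl vfieldZ /F unlift_none.
  by congr (_ + _); apply: eq_bigr => j _; rewrite liftK vfieldZ.
have s00 : s 0 ord0 != 0.
  apply: contra_neq s0 => s00.
  pose V := \matrix_(i < n, j < n) v i (f j) p.
  pose t := \col_j s 0 (lift ord0 j).
  have Vu : V \in unitmx.
    rewrite unitmxE unitfE; move: det0; rewrite -[X in X != 0 -> _]/(evalC p _) -det_map_mx.
    by congr (\det _ != 0); apply/matrixP => i j; rewrite !mxE.
  have Vt : V *m t = 0.
    apply/colP => i; rewrite !mxE; have := sX (v i); rewrite s00 mul0r add0r => E.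
    by rewrite -[RHS]E; apply: eq_bigr => j _; rewrite !mxE mulrC.
  have t0 : t = 0 by rewrite -(mulKmx Vu t) Vt mulmx0.
  apply/rowP => k; rewrite mxE; case: (unliftP ord0 k) => [j|] ->//.
  by have := congr1 (fun A : 'cV[R]_n => A j 0) t0; rewrite !mxE.
exists (fun j => - (s 0 ord0)^-1 * s 0 (lift ord0 j)) => X.
under eq_bigr do rewrite -mulrA; rewrite -mulr_sumr.
have /eqP := sX X; rewrite addr_eq0 => /eqP E.
by rewrite mulNr -mulrN -E mulKf.
Qed.

(** Where the Jacobian determinant [m] vanishes there is nothing to prove; elsewhere the
differentials of the [f_j] span by [vfield_combination], and the relation is the inversion of a matrix by its adjugate.
The additional factor [m] covers the first case. *)
Lemma vfield_frame_relation (v : 'I_n -> vfield M) (f : 'I_n -> C) X :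
  let m := \det (\matrix_(i, j) v i (f j)) in
  m *: (m *: X) = m *: \sum_i (\sum_j X (f j) * (\adj (\matrix_(i, j) v i (f j))) j i) *: v i.
Proof.
set V := \matrix_(i, j) v i (f j); move=> m; apply: vfield_ext => g; apply: Coo_ext => p.
rewrite !vfieldZl !evalCM vfield_suml evalC_sum.
have [->|mp] := eqVneq (m p) 0; first by rewrite !mul0r.
have [t Ht] := vfield_combination g mp.
congr (_ * _); rewrite Ht mulr_sumr.
under [RHS]eq_bigr => i _ do rewrite vfieldZl evalCM evalC_sum Ht mulr_suml.
rewrite exchange_big /=; apply: eq_bigr => j _.
have adjV k : \sum_i (\adj V j i) p * v i (f k) p = m p * (j == k)%:R.
  have := congr1 (fun A : 'M[C]_n => A j k p) (mul_adj_mx V); rewrite !mxE evalC_sum.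
  have -> : ((\det V *+ (j == k)) p) = m p * (j == k)%:R.
    by case: eqP; rewrite ?mulr1// mulr0.
  by move=> <-; apply: eq_bigr => i _; rewrite evalCM !mxE.
transitivity (\sum_i \sum_k (X (f j) p * t k) * ((\adj V) j i p * v i (f k) p)); last first.
  apply: eq_bigr => i _; rewrite mulr_sumr; apply: eq_bigr => k _.
  transitivity ((X (f j) p * (\adj V) j i p) * (t k * v i (f k) p)); [ring|by []].
rewrite exchange_big/= [RHS](bigD1 j)//= [X in _ = _ + X]big1 ?addr0 => [|k kj].
  by rewrite -mulr_sumr adjV eqxx mulr1; ring.
by rewrite -mulr_sumr adjV eq_sym (negPf kj) !mulr0.
Qed.

End Rank.

(** * Consequences of a volume form *)

Section VolumeForms.
Context {R : realType} {n : nat} (M : manifold R n).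
Local Notation C := (Coo M).
Implicit Types (f g h : C) (X Y : vfield M) (p : M) (v : 'I_n -> vfield M).
Variables (mu : ('I_n -> vfield M) -> C) (vol_mu : volume_form mu).

Let alt_mu : alternating_form mu := vol_mu.1.

Definition minor (k : nat) (V : nat -> vfield M) (F : nat -> C) : C :=
  \det (\matrix_(i < k, j < k) V i (F j)).

(** If all extensions of the minor by one more function vanished, then their expansion along the
last column would be a linear relation between the first [k + 1] vector fields with the smaller minor as a
coefficient; put into slot [k] of the volume form, it would give zero. *)
Lemma minor_extend b (V : nat -> vfield M) (F : nat -> C) k : (k < n)%N ->
  b * mu (fun i => V i) * minor k V F <> 0 ->
  exists g, b * mu (fun i => V i) * minor k.+1 V (fun j => if j == k then g else F j) <> 0.
Proof.
move=> kn ne0; apply/not_existsP => H; apply: ne0.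
set v : 'I_n -> vfield M := fun i => V i.
pose A g := \matrix_(i < k.+1, j < k.+1) V i (if j == k :> nat then g else F j).
pose cof (i : 'I_k.+1) := cofactor (A 0) i ord_max.
have cofE g i : cofactor (A g) i ord_max = cof i.
  rewrite /cof /cofactor; congr (_ * \det _); apply/matrixP => a c.
  by rewrite !mxE lift_max ltn_eqF.
have cof_max : cof ord_max = minor k V F.
  rewrite /cof /cofactor -signr_odd oddD addbb mul1r; congr (\det _).
  apply/matrixP => a c; rewrite !mxE !lift_max ltn_eqF//.
(* The cofactors along the last column do not involve the last function [g]. *)
have rel : (b * mu v) *: \sum_(i < k.+1) cof i *: V i = 0.
  apply: vfield_ext => g; rewrite vfieldZl vfield_suml; have := H g => /contrapT E.
  rewrite -[RHS]E /minor -/(A g) (expand_det_col _ ord_max); congr (_ * _).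
  by apply: eq_bigr => i _; rewrite cofE vfieldZl !mxE eqxx mulrC.
pose kk : 'I_n := Ordinal kn.
have E0 : b * mu v * (minor k V F * mu v) = 0.
  have := congr1 (fun x => mu (update v kk x)) rel.
  rewrite (alternating0 alt_mu) (alternatingZ alt_mu) (alternating_sum alt_mu) big_ord_recr /=.
  rewrite big1 ?add0r => [|i _]; last first.
    rewrite (alternatingZ alt_mu).
    have ik : (i < n)%N := ltn_trans (ltn_ord i) kn.
    rewrite (@alternating_eq0 _ _ _ _ alt_mu _ kk (Ordinal ik)) ?mulr0//.
      by rewrite -val_eqE /= gtn_eqF.
    by rewrite update_same update_other// -val_eqE /= ltn_eqF.
  by rewrite (alternatingZ alt_mu) -/ord_max cof_max (update_id v kk).
apply: Coo_ext => p; have := congr1 (fun f : C => f p) E0.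
rewrite !evalCM evalC0 => /eqP; rewrite !mulf_eq0 -!orbA.
by move=> /or4P[] /eqP ->; rewrite ?(mulr0, mul0r).
Qed.

(** This replaces the pointwise statement that the [v_i] are independent wherever [mu v] is
nonzero: it asserts a nonzero value somewhere only, and is proved without vector fields other than
the given ones. *)
Lemma exists_minor b v : b * mu v <> 0 ->
  exists f : 'I_n -> C, b * mu v * \det (\matrix_(i, j) v i (f j)) <> 0.
Proof.
move=> ne0; pose V k := if insub k is Some i then v i else 0.
have VE : (fun i : 'I_n => V i) = v by apply/funext => i; rewrite /V valK.
have H k : (k <= n)%N -> exists F, b * mu (fun i : 'I_n => V i) * minor k V F <> 0.
  elim: k => [|k IH] kn; first by exists (fun=> 0); rewrite /minor det_mx00 mulr1 VE.
  have [F /(minor_extend kn)[g Hg]] := IH (ltnW kn).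
  by exists (fun j => if j == k then g else F j).
have [F HF] := H n (leqnn n); exists (fun j => F j); rewrite VE in HF.
have <- : minor n V F = \det (\matrix_(i < n, j < n) v i (F j)); last exact: HF.
by congr (\det _); apply/matrixP => i j; rewrite !mxE -[in RHS]VE.
Qed.

Lemma volume_neq0 b : b <> 0 -> exists v, b * mu v <> 0.
Proof.
move=> /Coo_neq0[p bp]; have [v vp] := vol_mu.2 p; exists v => E.
have := congr1 (fun f : C => f p) E; rewrite evalCM evalC0 => /eqP.
by rewrite mulf_eq0 (negPf bp) (negPf vp).
Qed.

(** After multiplication by the square of a Jacobian determinant, every one-form is a
combination of the [d f_j]. *)
Lemma oneform_exact_generated (xi : dual (oneform M)) :
  (forall f, xi (ext_diff f) = 0) -> forall alpha, xi alpha = 0.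
Proof.
move=> xi0 alpha; apply: contrapT => /volume_neq0[v /exists_minor[f Hf]].
set V := \matrix_(i, j) v i (f j) in Hf; set m := \det V in Hf.
pose e j := \sum_i \adj V j i *: v i.
have E : (m * m) *: alpha = \sum_j (m * alpha (e j)) *: ext_diff (f j).
  apply: dual_ext => X; rewrite dualZl -mulrA -!dualZr.
  have -> : m *: (m *: X) = m *: \sum_j X (f j) *: e j.
    rewrite vfield_frame_relation; congr (_ *: _).
    under [RHS]eq_bigr do rewrite scaler_sumr; rewrite exchange_big /=.
    apply: eq_bigr => i _; rewrite scaler_suml; apply: eq_bigr => j _.
    by rewrite scalerA.
  rewrite dualZr dual_sumr mulr_sumr dual_suml; apply: eq_bigr => j _.
  by rewrite dualZl dualZr /=; ring.
have E0 : m * m * xi alpha = 0.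
  rewrite -dualZr E dual_sumr big1// => j _; by rewrite dualZr xi0 mulr0.
apply: Hf; apply: Coo_ext => p; have := congr1 (fun f : C => f p) E0.
rewrite !evalCM evalC0 => /eqP; rewrite !mulf_eq0 orbb.
by move=> /orP[] /eqP ->; rewrite ?(mulr0, mul0r).
Qed.

(** The Cramer rule after multiplication by [mu v]: a Jacobian determinant of the family [v]
itself exhibits a multiple of [X] as a combination of the [v_i], for which the identity is formal. *)
Lemma volume_cramer_scaled v X :
  mu v *: (mu v *: X - \sum_i mu (update v i X) *: v i) = 0.
Proof.
set E := _ - _; apply: vfield_ext => g; rewrite vfieldZl; apply: contrapT => ne0.
have /exists_minor[f] : E g * mu v <> 0 by rewrite mulrC.
set V := \matrix_(i, j) v i (f j); set m := \det V => Hf; apply: Hf.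
pose c i := m * \sum_j X (f j) * \adj V j i.
have mX : (m * m) *: X = \sum_i c i *: v i.
  rewrite -scalerA vfield_frame_relation scaler_sumr.
  by apply: eq_bigr => i _; rewrite scalerA.
have mmu i : m * m * mu (update v i X) = c i * mu v.
  rewrite -(alternatingZ alt_mu) mX (alternating_sum alt_mu) (bigD1 i)//= big1 => [|j ji].
    by rewrite addr0 (alternatingZ alt_mu) update_id.
  rewrite (alternatingZ alt_mu) (@alternating_eq0 _ _ _ _ alt_mu _ i j) ?mulr0 1?eq_sym//.
  by rewrite update_same update_other.
have mE : (m * m) *: E = 0.
  rewrite /E scalerBr scalerA (mulrC (m * m) (mu v)) -(scalerA (mu v)) mX scaler_sumr scaler_sumr -sumrB big1// => i _.
  by rewrite !scalerA mmu mulrC subrr.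
have := congr1 (fun Y : vfield M => Y g) mE; rewrite vfieldZl => E0.
apply: Coo_ext => p; have := congr1 (fun f : C => f p) E0.
rewrite !evalCM evalC0 => /eqP; rewrite !mulf_eq0 orbb.
by move=> /orP[] /eqP ->; rewrite ?(mulr0, mul0r).
Qed.

Lemma slot_form_subproof v i : (fun X => mu (update v i X)) \in @linear_pred _ (vfield M).
Proof. by apply/asboolP => a X Y; exact: alternating_linear. Qed.

(** The contraction of the volume form with all the [v_j] except the one of index [i]; up to the factor
[mu v], the coframe dual to [v]. *)
Definition slot_form v i : oneform M := Dual (slot_form_subproof v i).

Lemma slot_form_dual v i j : slot_form v i (v j) = mu v * (i == j)%:R.
Proof.
rewrite /slot_form /dual_fun /=; have [->|ij] := eqVneq i j.
  by rewrite update_id mulr1.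
rewrite (@alternating_eq0 _ _ _ _ alt_mu _ i j) ?mulr0//.
by rewrite update_same update_other// eq_sym.
Qed.

Lemma volume_frame_scaled v :
  frame v (fun i => mu v *: slot_form v i) (mu v * mu v).
Proof.
split=> [X|i j]; last by rewrite dualZl slot_form_dual mulrA.
have /eqP := volume_cramer_scaled v X; rewrite scalerBr subr_eq0 scalerA => /eqP ->.
by rewrite scaler_sumr; apply: eq_bigr => i _; rewrite scalerA dualZl.
Qed.

Lemma vfield_has_frames : @has_frames R n M n (vfield M).
Proof.
move=> p; have [v vp] := vol_mu.2 p.
exists v, (fun i => mu v *: slot_form v i), (mu v * mu v).
by split; [exact: volume_frame_scaled|rewrite evalCM mulf_neq0].
Qed.

(** Evaluated on a function [g], the defect of the identity is an alternating form in [v]: the sum is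
the action on [mu] of the operator sending [Y] to [Y g * X]. By [volume_cramer_scaled] it vanishes on a family where [mu] is
nonzero, hence everywhere by [alternating_vanish]. *)
Lemma volume_cramer v X : mu v *: X = \sum_i mu (update v i X) *: v i.
Proof.
apply: vfield_ext => g; apply: Coo_ext => p; rewrite vfield_suml vfieldZl.
(* The operator [T] is linear over the functions: a derivation covering [0]. *)
pose T (Y : vfield M) := Y g *: X.
pose w (u : 'I_n -> vfield M) := X g * mu u + form_derivation (fun=> 0) T mu u.
have wE u : w u = mu u * X g - \sum_i mu (update u i X) * u i g.
  rewrite /w /form_derivation sub0r mulrC; congr (_ - _); apply: eq_bigr => i _.
  by rewrite (alternatingZ alt_mu) mulrC.
have aw : alternating_form w.
  apply: alternating_formD; first exact: alternating_formZ.
  apply: alternating_form_derivation => //.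
  - by rewrite addr0.
  - by move=> a b; rewrite !mulr0 addr0.
  - by move=> Y Z; rewrite /T vfieldDl scalerDl.
  - by move=> a Y; rewrite /T vfieldZl scale0r addr0 scalerA.
have [u up] := vol_mu.2 p.
have wu0 : w u p = 0.
  pose E := mu u *: X - \sum_i mu (update u i X) *: u i.
  have /eqP : mu u p * E g p = 0.
    exact: (congr1 (fun Y : vfield M => Y g p) (volume_cramer_scaled u X)).
  have -> : E g = w u.
    by rewrite wE /E vfieldDl -scaleN1r !vfieldZl vfield_suml mulN1r.
  by rewrite mulf_eq0 (negPf up) => /eqP.
have mm : (mu u * mu u) p != 0 by rewrite evalCM mulf_neq0.
have := alternating_vanish aw (volume_frame_scaled u) mm wu0 v.
rewrite wE evalCB => /eqP; rewrite subr_eq0 => /eqP ->.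
by rewrite evalC_sum.
Qed.

Lemma volume_frame v : frame v (slot_form v) (mu v).
Proof.
by split=> [X|i j]; [exact: volume_cramer|exact: slot_form_dual].
Qed.

End VolumeForms.

(** * Lie derivatives and divergence *)

Section LieDerivativesOfForms.
Context {R : realType} {n : nat} {M : manifold R n} (A : skew_algebroid M).

Lemma lie_dualD (a : A) (xi zeta : dual A) :
  lie_dual a (xi + zeta) = lie_dual a xi + lie_dual a zeta.
Proof.
apply: dual_ext => x; rewrite dualDl /= /lie_dual /dual_fun /=.
by rewrite -!/(dual_fun _ _) vfieldD opprD addrACA.
Qed.

Lemma lie_dualZ (a : A) f (xi : dual A) :
  lie_dual a (f *: xi) = f *: lie_dual a xi + anchor a f *: xi.
Proof.
apply: dual_ext => x; rewrite dualDl !dualZl.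
rewrite -[LHS]/(anchor a (f * xi x) - f * xi (bracket a x)).
rewrite -[lie_dual a xi x]/(anchor a (xi x) - xi (bracket a x)) vfieldM; ring.
Qed.

Lemma alternating_lie_form r (a : A) (w : ('I_r -> A) -> Coo M) :
  alternating_form w -> alternating_form (lie_form a w).
Proof.
move=> aw; apply: alternating_form_derivation => //.
- exact: vfieldD.
- exact: vfieldM.
- exact: bracketDr.
- exact: bracketZr.
Qed.

Lemma alternating_lie_multivector r (a : A) (w : ('I_r -> dual A) -> Coo M) :
  alternating_form w -> alternating_form (lie_multivector a w).
Proof.
move=> aw; apply: alternating_form_derivation => //.
- exact: vfieldD.
- exact: vfieldM.
- exact: lie_dualD.
- exact: lie_dualZ.
Qed.

End LieDerivativesOfForms.

Section Divergence.
Context {R : realType} {n : nat} (M : manifold R n).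
Local Notation C := (Coo M).
Implicit Types (f g h : C) (X Y : vfield M) (p : M) (v : 'I_n -> vfield M).
Variables (mu : ('I_n -> vfield M) -> C) (vol_mu : volume_form mu).

Let alt_mu : alternating_form mu := vol_mu.1.

Lemma volume_cancel f g : (forall v, f * mu v = g * mu v) -> f = g.
Proof.
move=> E; apply: Coo_ext => p; have [v vp] := vol_mu.2 p.
by apply: (mulIf vp); exact: (congr1 (fun f : C => f p) (E v)).
Qed.

(** The Lie derivative of a volume form is a top form, so it is a smooth multiple of the volume form. *)
Lemma lie_volume X v : lie_form (A := tangent M) X mu v = divergence mu X * mu v.
Proof.
have [g Hg] := top_form_quotient (vfield_has_frames vol_mu) vol_mu
  (@alternating_lie_form _ _ _ (tangent M) _ X _ alt_mu).
rewrite /divergence; case: xgetP => [h _ Hh|/(_ g)]; first exact: Hh.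
by case; exact: Hg.
Qed.

Lemma lie_volumeE X v : divergence mu X * mu v =
  X (mu v) - \sum_i mu (update v i (lie_vf X (v i))).
Proof. by rewrite -lie_volume. Qed.

Lemma divergenceD X Y : divergence mu (X + Y) = divergence mu X + divergence mu Y.
Proof.
apply: volume_cancel => v; rewrite mulrDl !lie_volumeE.
under eq_bigr do rewrite lie_vfDl (alternatingD alt_mu).
by rewrite vfieldDl big_split /=; ring.
Qed.

(** The correction term [X f] comes from the Cramer rule, evaluated on [f]. *)
Lemma divergenceZ f X : divergence mu (f *: X) = f * divergence mu X + X f.
Proof.
apply: volume_cancel => v; rewrite mulrDl -mulrA !lie_volumeE mulrBr.
under eq_bigr do rewrite lie_vfZl (alternatingD alt_mu) (alternatingZ alt_mu) -scaleNr (alternatingZ alt_mu).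
rewrite vfieldZl big_split -mulr_sumr /=.
have -> : X f * mu v = \sum_i v i f * mu (update v i X).
  have : (mu v *: X) f = (\sum_i mu (update v i X) *: v i) f.
    by rewrite -(volume_cramer vol_mu).
  rewrite vfieldZl vfield_suml mulrC => ->.
  by apply: eq_bigr => i _; rewrite mulrC.
rewrite opprD addrA; congr (_ + _); rewrite -sumrN.
by apply: eq_bigr => i _; rewrite mulNr opprK.
Qed.

(** The Lie derivative of [mu] along a commutator is the commutator of Lie derivatives, and
each of them multiplies [mu] by a function. *)
Lemma divergence_lie X Y :
  divergence mu (lie_vf X Y) = X (divergence mu Y) - Y (divergence mu X).
Proof.
apply: volume_cancel => v; rewrite -lie_volume.
(* Jacobi identity for vector fields. *)
have J Z : lie_vf (lie_vf X Y) Z = lie_vf X (lie_vf Y Z) - lie_vf Y (lie_vf X Z).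
  by apply: vfield_ext => f; rewrite vfieldBl !lie_vfE !vfieldB; ring.
have LE Z : lie_form (A := tangent M) Z mu = fun v => divergence mu Z * mu v.
  by apply/funext => u; exact: lie_volume.
have muB u i x y : mu (update u i (x - y)) = mu (update u i x) - mu (update u i y).
  by rewrite (alternatingD alt_mu) -scaleN1r (alternatingZ alt_mu) mulN1r.
have := @form_derivation_comm _ _ _ X Y (lie_vf X) (lie_vf Y) mu v (vfieldB X) (vfieldB Y) muB.
have LM (Z : vfield M) g : form_derivation Z (lie_vf Z) (fun u => g * mu u) v =
    Z g * mu v + g * (divergence mu Z * mu v).
  rewrite /form_derivation -mulr_sumr lie_volumeE vfieldM; ring.
have -> : form_derivation Y (lie_vf Y) mu = fun v => divergence mu Y * mu v by exact: (LE Y).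
have -> : form_derivation X (lie_vf X) mu = fun v => divergence mu X * mu v by exact: (LE X).
rewrite !LM => E.
transitivity (form_derivation (fun a => X (Y a) - Y (X a))
   (fun x => lie_vf X (lie_vf Y x) - lie_vf Y (lie_vf X x)) mu v).
  by rewrite /lie_form /form_derivation; congr (_ - _); apply: eq_bigr => i _; rewrite -J.
by rewrite -E; ring.
Qed.

End Divergence.

(** * Modular vector fields and the trace of the Koszul bracket *)

Section ModularField.
Context {R : realType} {n : nat} (M : manifold R n).
Local Notation C := (Coo M).
Implicit Types (f g h : C) (X Y : vfield M) (p : M) (v : 'I_n -> vfield M).
Implicit Types (alpha beta gamma : oneform M).

Lemma ext_diffD f g : ext_diff (f + g) = ext_diff f + ext_diff g.
Proof. by apply: dual_ext => X; rewrite dualDl; exact: vfieldD. Qed.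

Lemma ext_diffM f g : ext_diff (f * g) = f *: ext_diff g + g *: ext_diff f.
Proof. by apply: dual_ext => X; rewrite dualDl !dualZl; exact: vfieldM. Qed.

Lemma ext_diff_cst a f : ext_diff (constC M a * f) = constC M a *: ext_diff f.
Proof. by apply: dual_ext => X; rewrite dualZl; exact: vfieldZ. Qed.

Lemma ext_diffE f X : ext_diff f X = X f. Proof. by []. Qed.

Lemma lie_oneformE X alpha Y : lie_oneform X alpha Y = X (alpha Y) - alpha (lie_vf X Y).
Proof. by []. Qed.

Lemma dual0r (L : lmodType C) (xi : dual L) : xi 0 = 0.
Proof. by rewrite -(scale0r (0 : L)) dualZr mul0r. Qed.

Lemma dualBr (L : lmodType C) (xi : dual L) x y : xi (x - y) = xi x - xi y.
Proof. by rewrite dualDr dualNr. Qed.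

Lemma dualBl (L : lmodType C) (xi zeta : dual L) x : (xi - zeta) x = xi x - zeta x.
Proof. by []. Qed.

Variable pi : bivector M.

Lemma koszul_ext_diff f beta :
  koszul pi (ext_diff f) beta = lie_oneform (hamiltonian pi f) beta.
Proof.
apply: dual_ext => X; rewrite koszulE lie_oneformE -/(hamiltonian pi f) !ext_diffE lie_vfE.
rewrite -[pi beta f]/(ext_diff f (pi beta)) (bivector_form_skew pi (ext_diff f) beta) vfieldN -/(hamiltonian pi f).
ring.
Qed.

Lemma koszulDl alpha beta gamma :
  koszul pi (alpha + beta) gamma = koszul pi alpha gamma + koszul pi beta gamma.
Proof.
apply: dual_ext => X; rewrite dualDl !koszulE linearD !dualDl !dualDr lie_vfDl dualDr.
by rewrite vfieldDl !vfieldD; ring.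
Qed.

Lemma koszulZl f alpha beta :
  koszul pi (f *: alpha) beta = f *: koszul pi alpha beta - pi beta f *: alpha.
Proof.
apply: dual_ext => X; rewrite [RHS]dualBl [(_ *: koszul _ _ _) X]dualZl !koszulE linearZ !dualZl dualZr lie_vfZl dualBr !dualZr.
by rewrite vfieldZl !vfieldM; ring.
Qed.

Section Volume.
Variables (mu : ('I_n -> vfield M) -> C) (vol_mu : volume_form mu).

Lemma modular_vf_subproof :
  (fun f => divergence mu (hamiltonian pi f)) \in @derivation_pred R n M.
Proof.
apply/asboolP; split=> [f g|a f|f g].
- by rewrite /hamiltonian ext_diffD linearD divergenceD.
- by rewrite /hamiltonian ext_diff_cst linearZ divergenceZ// vfield_cst addr0.
rewrite /hamiltonian ext_diffM linearD !linearZ divergenceD// !divergenceZ//.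
have -> : pi (ext_diff g) f = - pi (ext_diff f) g.
  exact: (bivector_form_skew pi (ext_diff g) (ext_diff f)).
ring.
Qed.

Lemma modular_vfE f : modular_vf pi mu f = divergence mu (hamiltonian pi f).
Proof.
rewrite /modular_vf; case: xgetP => [X _ HX|/(_ (VField modular_vf_subproof))]; first exact: HX.
by case.
Qed.

(** The trace of the Koszul bracket with [alpha] in the frame dual to [v], up to the factor
[mu v]. *)
Definition koszul_trace v alpha : C :=
  \sum_i koszul pi alpha (slot_form vol_mu v i) (v i).

Lemma koszul_traceD v alpha beta :
  koszul_trace v (alpha + beta) = koszul_trace v alpha + koszul_trace v beta.
Proof.
by rewrite /koszul_trace -big_split; apply: eq_bigr => i _; rewrite koszulDl.
Qed.

Lemma koszul_traceZ v f alpha :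
  koszul_trace v (f *: alpha) = f * koszul_trace v alpha - mu v * pi alpha f.
Proof.
rewrite /koszul_trace mulr_sumr.
have -> : mu v * pi alpha f = \sum_i pi (slot_form vol_mu v i) f * alpha (v i).
  have [span _] := dual_frame (volume_frame vol_mu v).
  have : pi (mu v *: alpha) f = pi (\sum_j alpha (v j) *: slot_form vol_mu v j) f.
    by rewrite span.
  rewrite linearZ vfieldZl => ->; rewrite linear_sum vfield_suml.
  by apply: eq_bigr => i _; rewrite linearZ vfieldZl mulrC.
rewrite -sumrB; apply: eq_bigr => i _.
by rewrite koszulZl dualBl !dualZl.
Qed.

(** The bracket with an exact form is a Lie derivative, so that its trace is a divergence. *)
Lemma koszul_trace_exact v f : koszul_trace v (ext_diff f) =
  (n%:R - 1) * hamiltonian pi f (mu v) + divergence mu (hamiltonian pi f) * mu v.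
Proof.
rewrite /koszul_trace lie_volumeE//.
under eq_bigr do rewrite koszul_ext_diff lie_oneformE slot_form_dual eqxx mulr1.
by rewrite sumrB sumr_const card_ord -[X in X - _]mulr_natl; ring.
Qed.

(** The difference of both sides is linear over the smooth functions, since the Leibniz terms of
the trace and of the divergence cancel; on exact forms it vanishes because [X_mu f] is the divergence of
the Hamiltonian vector field of [f]. *)
Lemma koszul_traceE v alpha : koszul_trace v alpha =
  (n%:R - 1) * pi alpha (mu v) - mu v * divergence mu (pi alpha)
  + 2%:R * mu v * alpha (modular_vf pi mu).
Proof.
pose F alpha := koszul_trace v alpha - ((n%:R - 1) * pi alpha (mu v) -
  mu v * divergence mu (pi alpha) + 2%:R * mu v * alpha (modular_vf pi mu)).
have FP : F \in @linear_pred _ (oneform M).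
  apply/asboolP => f a b; rewrite /F koszul_traceD koszul_traceZ.
  rewrite linearD linearZ divergenceD// divergenceZ// dualDl dualZl vfieldDl vfieldZl.
  by ring.
apply/eqP; rewrite -subr_eq0; apply/eqP.
apply: (oneform_exact_generated vol_mu (xi := Dual FP)) => f.
rewrite -[LHS]/(F (ext_diff f)) /F koszul_trace_exact ext_diffE modular_vfE.
by rewrite -/(hamiltonian pi f); ring.
Qed.

End Volume.
End ModularField.

(** * The relative modular cocycle *)

Section RelativeModularCocycle.
Context {R : realType} {n : nat} (M : manifold R n).
Local Notation C := (Coo M).
Variables (mu : ('I_n -> vfield M) -> C) (vol_mu : volume_form mu).
Variables (pi pi' : bivector M) (phi : {linear cotangent pi -> cotangent pi'}).
Hypothesis anchor_phi : forall alpha : oneform M, pi' (phi alpha) = pi alpha.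
Variables (eta : ('I_n -> dual (cotangent pi)) -> C) (nu : ('I_n -> cotangent pi') -> C).
Hypotheses (nv_eta : nonvanishing_form eta) (nv_nu : nonvanishing_form nu).

Lemma relative_modular_subproof (l : C) :
  (fun alpha : oneform M => 2%:R * (alpha (modular_vf pi mu) -
     (phi alpha : oneform M) (modular_vf pi' mu)) + pi alpha l) \in @linear_pred _ (oneform M).
Proof.
apply/asboolP => f a b; rewrite linearP.
rewrite (linearP pi) !dualDl !dualZl vfieldDl vfieldZl; ring.
Qed.

Definition relative_modular_form (l : C) : dual (cotangent pi) :=
  Dual (relative_modular_subproof l).

(** Both sides are top forms in [u] and in [x], hence it suffices to compare them on the
frame of a family [v] and its dual. There the two Lie derivatives are given by traces of Koszul brackets, and [l] is
the logarithm of the absolute value of the pairing of [eta] and [nu]. *)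
Lemma relative_modular_formP : exists l,
  is_relative_modular_cocycle phi eta nu (relative_modular_form l).
Proof.
have F1 := dual_has_frames (vfield_has_frames vol_mu).
have [h h0 hE] := top_forms_pairing F1 nv_eta nv_nu.
have [l lE] := exists_log h0; exists l => alpha u x; apply: Coo_ext => p.
set xi := relative_modular_form l.
pose W u x := lie_multivector alpha eta u * nu x + eta u * lie_form (phi alpha) nu x
  - xi alpha * (eta u * nu x).
suff : W u x p = 0 by rewrite /W evalCB => /eqP; rewrite subr_eq0 => /eqP.
have [aeta _] := nv_eta; have [anu _] := nv_nu.
have aWu y : alternating_form (W ^~ y).
  have := alternating_formD (alternating_formZ (nu y) (alternating_lie_multivector alpha aeta))
    (alternating_formZ (lie_form (phi alpha) nu y - xi alpha * nu y) aeta).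
  congr (alternating_form _); apply/funext => z; rewrite /W; ring.
have aWx z : alternating_form (W z).
  have := alternating_formD (alternating_formZ (lie_multivector alpha eta z - xi alpha * eta z) anu)
    (alternating_formZ (eta z) (alternating_lie_form (phi alpha) anu)).
  congr (alternating_form _); apply/funext => y; rewrite /W; ring.
(* Reduction to a frame, first in [u], then in [x]. *)
have [v vp] := vol_mu.2 p; pose m := mu v.
have Fv := volume_frame vol_mu v; have Fb := dual_frame Fv; have Fbs := dual_frame Fb.
pose b : 'I_n -> cotangent pi' := slot_form vol_mu v.
pose bs : 'I_n -> dual (cotangent pi) := fun i => dual_eval (v i).
suff H : W bs b p = 0.
  apply: (alternating_vanish (aWu x) Fbs vp).
  exact: (alternating_vanish (aWx bs) Fb vp).
pose X := pi alpha.
have E1 : m * lie_multivector alpha eta bs =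
    m * X (eta bs) - (n%:R * X m - koszul_trace pi vol_mu v alpha) * eta bs.
  rewrite [LHS](form_derivation_frame _ _ Fbs aeta); congr (_ - _ * _).
  have -> : n%:R * X m = \sum_(i < n) X m by rewrite sumr_const card_ord mulr_natl.
  rewrite -sumrB; apply: eq_bigr => i _.
  rewrite -[LHS]/(X (slot_form vol_mu v i (v i)) - koszul pi alpha (slot_form vol_mu v i) (v i)).
  by rewrite slot_form_dual eqxx mulr1.
have E2 : m * lie_form (phi alpha) nu b =
    m * X (nu b) - koszul_trace pi' vol_mu v (phi alpha) * nu b.
  rewrite /X -anchor_phi; exact: (form_derivation_frame _ _ Fb anu).
have E3 : eta bs * nu b = h * m ^+ n.
  rewrite hE -det_scalar; congr (_ * \det _); apply/matrixP => i j; rewrite !mxE.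
  by rewrite -[LHS]/(slot_form vol_mu v j (v i)) slot_form_dual mulr_natr eq_sym.
(* The terms in [X] cancel here, as both anchors give the same [X]. *)
have E4 : koszul_trace pi vol_mu v alpha - koszul_trace pi' vol_mu v (phi alpha) =
    m * (xi alpha - X l).
  rewrite !koszul_traceE// anchor_phi -/X -/m.
  rewrite -[xi alpha]/(2%:R * (alpha (modular_vf pi mu) -
     (phi alpha : oneform M) (modular_vf pi' mu)) + X l); ring.
have E5 : m * X (eta bs * nu b) = (m * X l + n%:R * X m) * (eta bs * nu b).
  rewrite E3 vfieldM mulrDr [m * (h * _)]mulrCA vfieldXn -lE; ring.
have : m * W bs b = 0.
  rewrite /W mulrBr mulrDr mulrA E1 mulrCA E2.
  transitivity (m * X (eta bs * nu b) - (n%:R * X m - (koszul_trace pi vol_mu v alpha -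
     koszul_trace pi' vol_mu v (phi alpha))) * (eta bs * nu b) - m * (xi alpha * (eta bs * nu b))).
    rewrite vfieldM; ring.
  rewrite E4 E5; ring.
move=> /(congr1 (fun f : C => f p)) /eqP; rewrite evalCM mulf_eq0 (negPf vp).
by move=> /eqP.
Qed.

Lemma relative_modular_cocycle_unique xi zeta :
  is_relative_modular_cocycle phi eta nu xi ->
  is_relative_modular_cocycle phi eta nu zeta -> xi = zeta.
Proof.
move=> xiP zetaP; apply: dual_ext => alpha; apply: Coo_ext => p.
have [u up] := nv_eta.2 p; have [x xp] := nv_nu.2 p.
have E : xi alpha * (eta u * nu x) = zeta alpha * (eta u * nu x).
  by rewrite -xiP -zetaP.
apply: (mulIf (mulf_neq0 up xp)); exact: (congr1 (fun f : C => f p) E).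
Qed.

Lemma relative_modular_cocycleE : exists l,
  relative_modular_cocycle phi eta nu = relative_modular_form l.
Proof.
have [l lP] := relative_modular_formP; exists l.
rewrite /relative_modular_cocycle; case: xgetP => [xi _ xiP|/(_ _ lP)//].
exact: relative_modular_cocycle_unique.
Qed.

End RelativeModularCocycle.

(** * Poisson vector fields *)

Section PoissonFields.
Context {R : realType} {n : nat} (M : manifold R n).
Local Notation C := (Coo M).
Implicit Types (f g h : C) (X Y : vfield M) (alpha beta gamma : oneform M).
Variables (mu : ('I_n -> vfield M) -> C) (vol_mu : volume_form mu).
Variable pi : bivector M.

Lemma hamiltonian_skew f g : hamiltonian pi f g = - hamiltonian pi g f.
Proof. exact: (bivector_form_skew pi (ext_diff f) (ext_diff g)). Qed.

Lemma lie_oneform_ext_diff X f : lie_oneform X (ext_diff f) = ext_diff (X f).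
Proof.
by apply: dual_ext => Y; rewrite lie_oneformE !ext_diffE lie_vfE; ring.
Qed.

Lemma lie_oneformZ X f alpha :
  lie_oneform X (f *: alpha) = f *: lie_oneform X alpha + X f *: alpha.
Proof. exact: (lie_dualZ (A := tangent M)). Qed.

Lemma lie_oneformD X alpha beta :
  lie_oneform X (alpha + beta) = lie_oneform X alpha + lie_oneform X beta.
Proof. exact: (lie_dualD (A := tangent M)). Qed.

Lemma bilinear_exact_eq0 (F : oneform M -> oneform M -> C) :
  (forall beta, F ^~ beta \in @linear_pred _ (oneform M)) ->
  (forall alpha, F alpha \in @linear_pred _ (oneform M)) ->
  (forall f g, F (ext_diff f) (ext_diff g) = 0) ->
  forall alpha beta, F alpha beta = 0.
Proof.
move=> Fl Fr F0 alpha beta.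
apply: (oneform_exact_generated vol_mu (xi := Dual (Fl beta))) => f.
by apply: (oneform_exact_generated vol_mu (xi := Dual (Fr (ext_diff f)))) => g; exact: F0.
Qed.

Definition bracket_derivation X := forall f g,
  X (hamiltonian pi f g) = hamiltonian pi f (X g) - hamiltonian pi g (X f).

(** Being a Poisson vector field is a tensorial condition, so it can be tested on
exact forms. *)
Lemma bracket_derivation_poisson_vf X : bracket_derivation X -> poisson_vf pi X.
Proof.
move=> HX; apply: bilinear_exact_eq0 => [beta|alpha|f g].
- apply/asboolP => f a b; rewrite /bivector_form lie_oneformD lie_oneformZ.
  rewrite !linearD !linearZ !dualDr !dualZr !vfieldD vfieldM; ring.
- apply/asboolP => f a b; rewrite /bivector_form lie_oneformD lie_oneformZ.
  rewrite !dualDl !dualZl !vfieldD vfieldM; ring.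
rewrite /bivector_form !lie_oneform_ext_diff !ext_diffE.
rewrite -!/(hamiltonian pi _) HX (hamiltonian_skew (X f)); ring.
Qed.

Lemma poisson_vf_cocycle X alpha beta : poisson_vf pi X ->
  koszul pi alpha beta X = pi alpha (beta X) - pi beta (alpha X).
Proof.
move=> /(_ alpha beta); rewrite /bivector_form.
rewrite (bivector_form_skew pi (lie_oneform X alpha)) !lie_oneformE.
rewrite koszulE (lie_vfC (pi alpha)) (lie_vfC (pi beta)) !dualNr.
rewrite (bivector_form_skew pi beta alpha) vfieldN => E.
apply/eqP; rewrite -subr_eq0; apply/eqP; rewrite -E; ring.
Qed.

Definition anchor_morphism := forall alpha beta,
  pi (koszul pi alpha beta) = lie_vf (pi alpha) (pi beta).

Lemma koszul_exact f g :
  koszul pi (ext_diff f) (ext_diff g) = ext_diff (hamiltonian pi f g).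
Proof. by rewrite koszul_ext_diff lie_oneform_ext_diff. Qed.

(** A tensorial identity, which is the Jacobi identity on exact forms. *)
Lemma poisson_anchor_morphism : poisson pi -> anchor_morphism.
Proof.
move=> Jac alpha beta; apply: vfield_ext => h; apply/eqP; rewrite -subr_eq0; apply/eqP.
apply: (bilinear_exact_eq0 (F := fun alpha beta =>
  pi (koszul pi alpha beta) h - lie_vf (pi alpha) (pi beta) h)) => {alpha beta} [beta|alpha|f g].
- apply/asboolP => f a b; rewrite koszulDl koszulZl.
  move: (koszul pi a beta) (koszul pi b beta) => k1 k2.
  have -> : pi (f *: k1 - pi beta f *: a + k2) = f *: pi k1 - pi beta f *: pi a + pi k2.
    by rewrite linearD linearB !linearZ.
  rewrite linearP lie_vfDl lie_vfZl !vfieldDl !vfieldNl !vfieldZl; ring.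
- apply/asboolP => f a b; rewrite koszulDr koszulZr !linearD !linearZ lie_vfDr lie_vfZr.
  rewrite !vfieldDl !vfieldZl; ring.
rewrite koszul_exact -!/(hamiltonian pi _) lie_vfE.
have := Jac f g h; rewrite /poisson_bracket /bivector_form !ext_diffE -!/(hamiltonian pi _).
rewrite (hamiltonian_skew h f) vfieldN (hamiltonian_skew h) => E.
rewrite -[RHS]oppr0 -E; ring.
Qed.

(** The Hamiltonian vector field of a bracket is a commutator, whose divergence is
[divergence_lie]. *)
Lemma modular_bracket_derivation : anchor_morphism -> bracket_derivation (modular_vf pi mu).
Proof.
move=> Hpi f g; rewrite !modular_vfE// -divergence_lie//.
by rewrite /hamiltonian -Hpi koszul_exact.
Qed.

End PoissonFields.

(** * Poisson-Nijenhuis manifolds and the theorem *)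

Section PoissonNijenhuis.
Context {R : realType} {n : nat} (M : manifold R n) (P : poisson_nijenhuis M).
Local Notation C := (Coo M).
Local Notation N := (nij P).
Local Notation Nt := (transpose (nij P)).
Implicit Types (f g h : C) (X Y : vfield M) (alpha beta gamma : oneform M).
Variables (mu : ('I_n -> vfield M) -> C) (vol_mu : volume_form mu).

Lemma transposeE alpha X : Nt alpha X = alpha (N X). Proof. by []. Qed.

Lemma pi1E alpha : pi1 P alpha = pi0 P (Nt alpha).
Proof. exact: nij_sharp. Qed.

Lemma pi1_nij alpha : pi1 P alpha = N (pi0 P alpha).
Proof. by []. Qed.

(** The transpose is a morphism for the brackets. Applying the compatibility of [N] with
[pi0] to [alpha] and [Nt beta] leaves, after expansion of the brackets, the torsion of [N] paired with [beta]. *)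
Lemma transpose_koszul alpha beta :
  Nt (koszul (pi1 P) alpha beta) = koszul (pi0 P) (Nt alpha) (Nt beta).
Proof.
apply: dual_ext => Y; rewrite transposeE.
have E : koszul (pi1 P) alpha (Nt beta) Y = koszul (pi0 P) (Nt alpha) (Nt beta) Y
   + koszul (pi0 P) alpha (Nt (Nt beta)) Y - koszul (pi0 P) alpha (Nt beta) (N Y).
  exact: (congr1 (fun xi : oneform M => xi Y) (nij_koszul P alpha (Nt beta))).
have T : beta (N (lie_vf (N (pi0 P alpha)) Y)) + beta (N (lie_vf (pi0 P alpha) (N Y)))
   - beta (N (N (lie_vf (pi0 P alpha) Y))) - beta (lie_vf (N (pi0 P alpha)) (N Y)) = 0.
  by rewrite -dualDr -!dualBr nij_torsion dual0r.
have {}E : koszul (pi0 P) (Nt alpha) (Nt beta) Y = koszul (pi1 P) alpha (Nt beta) Y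
   - koszul (pi0 P) alpha (Nt (Nt beta)) Y + koszul (pi0 P) alpha (Nt beta) (N Y).
  by rewrite E; ring.
rewrite E (koszulE (pi1 P) alpha beta) (koszulE (pi1 P) alpha (Nt beta)).
rewrite (koszulE (pi0 P) alpha (Nt (Nt beta))) (koszulE (pi0 P) alpha (Nt beta)).
rewrite !pi1_nij -!nij_sharp !transposeE; apply/eqP; rewrite -subr_eq0; apply/eqP.
rewrite -[RHS]T; ring.
Qed.

Lemma pi1_anchor_morphism : anchor_morphism (pi1 P).
Proof.
move=> alpha beta; rewrite !pi1E transpose_koszul.
exact: (poisson_anchor_morphism vol_mu (@pi0_poisson _ _ _ P)).
Qed.

(** The two terms of [X_N] are derivations of the bracket of [pi1] for different reasons: the
modular vector field of [pi1] because [pi1] is Poisson, and [N X0] because the morphism property [transpose_koszul]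
turns the claim into the cocycle property of [X0] for [pi0]. *)
Lemma pn_modular_bracket_derivation : bracket_derivation (pi1 P) (pn_modular_vf P mu).
Proof.
have m0 := poisson_anchor_morphism vol_mu (@pi0_poisson _ _ _ P).
have X0P := bracket_derivation_poisson_vf vol_mu (modular_bracket_derivation vol_mu m0).
have X1D := modular_bracket_derivation vol_mu pi1_anchor_morphism.
set X0 := modular_vf (pi0 P) mu in X0P.
(* The field [N X0] acts on [g] as [X0] contracted with [Nt (ext_diff g)]. *)
have NX0D : bracket_derivation (pi1 P) (N X0).
  move=> f g; transitivity (Nt (ext_diff (hamiltonian (pi1 P) f g)) X0); first by [].
  rewrite -koszul_exact transpose_koszul (poisson_vf_cocycle _ _ X0P).
  by rewrite -!pi1E.
move=> f g; rewrite /pn_modular_vf -/X0 !vfieldBl X1D NX0D !vfieldB; ring.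
Qed.

End PoissonNijenhuis.

Theorem proposition5 (R : realType) (n : nat) (M : manifold R n)
    (P : poisson_nijenhuis M) (M_orientable : orientable M)
    (mu : ('I_n -> vfield M) -> Coo M)
    (eta : ('I_n -> dual (cotangent (pi1 P))) -> Coo M)
    (nu : ('I_n -> cotangent (pi0 P)) -> Coo M) :
  volume_form mu -> nonvanishing_form eta -> nonvanishing_form nu ->
  let X_N := pn_modular_vf P mu in
  let mod_N : set (dual (cotangent (pi1 P))) :=
    @relative_modular_class R n M (cotangent (pi1 P)) (cotangent (pi0 P))
      (transpose (nij P)) eta nu in
  H1_poisson (pi1 P) (poisson_class (pi1 P) X_N) /\
  [set eval_vf (pi1 P) X | X in poisson_class (pi1 P) X_N] =
  [set constC M (2^-1) *: xi | xi in mod_N].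
Proof.
move=> vol_mu nv_eta nv_nu X_N mod_N; split.
  exists X_N => //; apply: (bracket_derivation_poisson_vf vol_mu).
  exact: pn_modular_bracket_derivation.
pose rel := @relative_modular_cocycle R n M (cotangent (pi1 P)) (cotangent (pi0 P))
  (transpose (nij P)) eta nu.
have half : constC M 2^-1 * 2%:R = 1.
  by apply: Coo_ext => p; rewrite evalCM -[(_%:R : Coo M) p]/(1 + 1 : R) mulVf// (pnatr_eq0 R 2).
have [l lE] := relative_modular_cocycleE vol_mu (fun alpha => esym (pi1E P alpha)) nv_eta nv_nu.
(* Adding the coboundary of [f] on the right amounts to adding the Hamiltonian field of [h] on the left, where [f = - 2 h - l]. *)
have evalE (f h : Coo M) : f = - (2%:R * h) - l ->
    eval_vf (pi1 P) (X_N + hamiltonian (pi1 P) h) =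
    constC M 2^-1 *: (rel + coboundary (cotangent (pi1 P)) f).
  move=> ->; rewrite /rel lE; apply: dual_ext => alpha.
  rewrite dualZl dualDl -[LHS]/(alpha (X_N + pi1 P (ext_diff h))).
  rewrite -[coboundary _ _ alpha]/(pi1 P alpha (- (2%:R * h) - l)).
  rewrite -[relative_modular_form _ _ _ alpha]/(2%:R * (alpha (modular_vf (pi1 P) mu) -
     alpha (nij P (modular_vf (pi0 P) mu))) + pi1 P alpha l).
  rewrite dualDr /X_N /pn_modular_vf dualBr.
  rewrite -[alpha (pi1 P (ext_diff h))]/(bivector_form (pi1 P) (ext_diff h) alpha) /bivector_form.
  rewrite (bivector_form_skew (pi1 P) (ext_diff h) alpha) ext_diffE.
  rewrite vfieldB vfieldN.
  have -> : 2%:R * h = h + h by ring.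
  rewrite vfieldD.
  transitivity (constC M 2^-1 * 2%:R * (alpha (modular_vf (pi1 P) mu) -
    alpha (nij P (modular_vf (pi0 P) mu)) - pi1 P alpha h)); first by rewrite half mul1r.
  ring.
apply/seteqP; split=> [_ [_ [h ->] <-]|_ [_ [f ->] <-]].
- exists (rel + coboundary (cotangent (pi1 P)) (- (2%:R * h) - l)).
    by eexists.
  by rewrite -(evalE _ h).
- exists (X_N + hamiltonian (pi1 P) (- (constC M 2^-1 * (l + f)))); first by eexists.
  apply: evalE; rewrite mulrN opprK mulrA [2%:R * _]mulrC half mul1r; ring.
Qed.
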